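(* Let $X$ and $Z$ be any two nondegenerate observables on a $d$-dimensional Hilbert space $\mathcal H_A$, with orthonormal eigenbases $\{|\varphi_x\rangle\}_{x\in\mathsf X}$ and $\{|\theta_z\rangle\}_{z\in\mathsf Z}$ respectively. Let $\mathcal E:L^\infty(\mathsf Y)\otimes\mathcal B(\mathcal H_B)\to\mathcal B(\mathcal H_A)$ be any quantum instrument with classical output in a finite set $\mathsf Y$ and finite-dimensional quantum output space $\mathcal H_B$. Then $$\sqrt{2\varepsilon_X(\mathcal E)}+\nu_Z(\mathcal E)\;\ge\; c_M(X,Z)\qquad\text{and}\qquad \varepsilon_X(\mathcal E)+\sqrt{2\nu_Z(\mathcal E)}\;\ge\; c_M(Z,X),$$ where $\varepsilon_X$ is the measurement error, $\nu_Z$ the measurement disturbance, and $c_M$ the complementarity measure defined in the context.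
   Context: Heisenberg picture: a quantum channel is a completely positive unital linear map from the algebra of observables of the output system to that of the input system. A quantum system with Hilbert space $\mathcal H$ has algebra $\mathcal B(\mathcal H)$; a classical system with values in a finite set $\mathsf Y$ has algebra $L^\infty(\mathsf Y)$ (functions on $\mathsf Y$); hybrid systems have the tensor product algebra. A quantum instrument is a channel $\mathcal E:L^\infty(\mathsf Y)\otimes\mathcal B(\mathcal H_B)\to\mathcal B(\mathcal H_A)$. Juxtaposition of channels is composition of maps: $(\mathcal E\mathcal F)(a)=\mathcal E(\mathcal F(a))$. Distinguishability: for channels $\mathcal E_1,\mathcal E_2$ between the same algebras, $\delta(\mathcal E_1,\mathcal E_2)=\tfrac12\|\mathcal E_1-\mathcal E_2\|_{\rm cb}$, where $\|T\|_{\rm cb}=\sup_{n\in\mathbb N}\|\mathrm{id}_n\otimes T\|_\infty$ and $\|\cdot\|_\infty$ is the norm of a linear map with respect to operator norms. Ideal measurements: $\mathcal Q_X:L^\infty(\mathsf X)\to\mathcal B(\mathcal H_A)$, $\mathcal Q_X(f)=\sum_x f(x)|\varphi_x\rangle\langle\varphi_x|$, and $\mathcal Q_Z:L^\infty(\mathsf Z)\to\mathcal B(\mathcal H_A)$, $\mathcal Q_Z(f)=\sum_z f(z)|\theta_z\rangle\langle\theta_z|$. Measurement error: $\varepsilon_X(\mathcal E)=\inf_{\mathcal R}\delta(\mathcal Q_X,\mathcal E_{\mathcal R})$, where the infimum is over channels (classical postprocessings) $\mathcal R:L^\infty(\mathsf X)\to L^\infty(\mathsf Y)$ and $\mathcal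 E_{\mathcal R}(f)=\mathcal E(\mathcal R(f)\otimes\mathbb 1_B)$. Measurement disturbance: $\nu_Z(\mathcal E)=\inf_{\mathcal R}\delta(\mathcal Q_Z,\mathcal E\mathcal R\mathcal Q_Z)$, where the infimum is over channels (recovery maps) $\mathcal R:\mathcal B(\mathcal H_A)\to L^\infty(\mathsf Y)\otimes\mathcal B(\mathcal H_B)$. Complementarity measure: $c_M(X,Z)=\nu_Z(\mathcal Q_X)$, with $\mathcal Q_X$ regarded as an instrument having only the classical output $\mathsf X$; that is, $c_M(X,Z)=\inf_{\mathcal R}\delta(\mathcal Q_Z,\mathcal Q_X\mathcal R\mathcal Q_Z)$ over channels $\mathcal R:\mathcal B(\mathcal H_A)\to L^\infty(\mathsf X)$. Equivalently $c_M(X,Z)=\inf_{\mathcal R}\delta(\mathcal Q_Z,\mathcal Q_X\mathcal R)$ over channels $\mathcal R:L^\infty(\mathsf Z)\to L^\infty(\mathsf X)$. $c_M(Z,X)$ is the same with the roles of $X$ and $Z$ exchanged. *)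

(* Defs.v *)
From HB Require Import structures.
From mathcomp Require Import all_boot all_order all_algebra.
From mathcomp Require Import sesquilinear spectral.
From mathcomp Require Import complex mxtens.
From mathcomp Require Import all_classical all_reals all_analysis.

Set Implicit Arguments.
Unset Strict Implicit.
Unset Printing Implicit Defensive.

Import Order.TTheory GRing.Theory Num.Theory.

Local Open Scope classical_set_scope.
Local Open Scope ring_scope.
Local Open Scope sesquilinear_scope.

(* The observable algebra L^oo(Y) (x) B(C^n) of a hybrid system, as the direct
   sum of #|Y| copies of the n x n matrices.  A purely quantum system is the
   case Y = unit and a purely classical one the case n = 1, a function
   f : Y -> C being encoded by the 1 x 1 matrices f y. *)
Notation obsalg R Y n := {ffun Y -> 'M[R[i]]_n}.

Definition obs1 (R : realType) (Y : finType) (n : nat) : obsalg R Y n :=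
  [ffun _ => 1%:M].

(* The Euclidean norm; the library norm `|v| of a matrix is the max norm. *)
Definition l2norm (R : realType) (n : nat) (v : 'cV[R[i]]_n) : R :=
  Num.sqrt (\sum_(i < n) ComplexField.Normc.normc (v i 0) ^+ 2).

(* Operator norms are \bar R-valued so that no supremum takes a junk value. *)
Definition opnorm (R : realType) (n : nat) (A : 'M[R[i]]_n) : \bar R :=
  ereal_sup [set (l2norm (A *m v))%:E | v in [set v | l2norm v <= 1]].

Definition obsnorm (R : realType) (Y : finType) (n : nat) (a : obsalg R Y n)
    : \bar R :=
  \big[maxe/0%E]_(y : Y) opnorm (a y).

Definition mapnorm (R : realType) (Y Y' : finType) (m m' : nat)
    (T : obsalg R Y m -> obsalg R Y' m') : \bar R :=
  ereal_sup [set obsnorm (T a) | a in [set a | (obsnorm a <= 1)%E]].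

Definition block (R : realType) (Y : finType) (k m : nat)
    (a : obsalg R Y (k * m)) (i j : 'I_k) : obsalg R Y m :=
  [ffun y => \matrix_(p < m, q < m)
     a y (mxtens_index (i, p)) (mxtens_index (j, q))].

(* id_k (x) T : M_k (x) A -> M_k (x) A', where M_k (x) (L^oo(Y) (x) M_m) is
   L^oo(Y) (x) M_(k * m), i.e. sum_(i, j) e_ij (x) a_ij goes to
   sum_(i, j) e_ij (x) T a_ij. *)
Definition ampl (R : realType) (Y Y' : finType) (m m' k : nat)
    (T : obsalg R Y m -> obsalg R Y' m')
    (a : obsalg R Y (k * m)) : obsalg R Y' (k * m') :=
  [ffun y => \sum_(i < k) \sum_(j < k)
     tensmx (delta_mx i j : 'M[R[i]]_k) (T (block a i j) y)].

Definition cbnorm (R : realType) (Y Y' : finType) (m m' : nat)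
    (T : obsalg R Y m -> obsalg R Y' m') : \bar R :=
  ereal_sup [set mapnorm (@ampl R Y Y' m m' k T) | k in [set: nat]].

Definition delta (R : realType) (Y Y' : finType) (m m' : nat)
    (S T : obsalg R Y m -> obsalg R Y' m') : \bar R :=
  ((2^-1 : R)%:E * cbnorm (fun a => (S a - T a)%R))%E.

(* In R[i], 0 <= z means that z is real and nonnegative. *)
Definition obs_pos (R : realType) (Y : finType) (n : nat) (a : obsalg R Y n)
    : Prop :=
  forall (y : Y) (v : 'cV[R[i]]_n), 0 <= (v ^t* *m a y *m v) 0 0.

Definition completely_positive (R : realType) (Y Y' : finType) (m m' : nat)
    (T : obsalg R Y m -> obsalg R Y' m') : Prop :=
  forall (k : nat) (a : obsalg R Y (k * m)), obs_pos a -> obs_pos (ampl T a).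

(* Heisenberg picture: T maps output observables to input observables. *)
Definition channel (R : realType) (Y Y' : finType) (m m' : nat)
    (T : obsalg R Y m -> obsalg R Y' m') : Prop :=
  [/\ linear T, completely_positive T & T (obs1 R Y m) = obs1 R Y' m'].

(* Simplicity of the spectrum is stated with the library's eigenspaces, which
   consist of row vectors; their dimensions agree with those for columns. *)
Definition nondegenerate_observable (R : realType) (d : nat)
    (A : 'M[R[i]]_d) : Prop :=
  A \is hermsymmx /\ forall c : R[i], (\rank (eigenspace A c) <= 1)%N.

Definition orthonormal_eigenbasis (R : realType) (d : nat) (X : finType)
    (A : 'M[R[i]]_d) (phi : X -> 'cV[R[i]]_d) : Prop :=
  [/\ forall x y : X, ((phi x) ^t* *m phi y) 0 0 = (x == y)%:R,
      forall v : 'cV[R[i]]_d,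
        exists c : X -> R[i], v = \sum_(x : X) c x *: phi x
    & forall x : X, exists c : R[i], A *m phi x = c *: phi x].

Definition ideal_meas (R : realType) (d : nat) (X : finType)
    (phi : X -> 'cV[R[i]]_d) (f : obsalg R X 1) : obsalg R unit d :=
  [ffun _ => \sum_(x : X) f x 0 0 *: (phi x *m (phi x) ^t*)].

(* f (x) 1_B in L^oo(Y) (x) B(H_B) *)
Definition tens1 (R : realType) (Y : finType) (n : nat) (f : obsalg R Y 1)
    : obsalg R Y n :=
  [ffun y => (f y 0 0)%:M].

Definition meas_error (R : realType) (d : nat) (X : finType)
    (phi : X -> 'cV[R[i]]_d) (Y : finType) (n : nat)
    (E : obsalg R Y n -> obsalg R unit d) : \bar R :=
  ereal_inf [set delta (ideal_meas phi) (fun f => E (tens1 n (P f)))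
            | P in [set P : obsalg R X 1 -> obsalg R Y 1 | channel P]].

Definition meas_disturbance (R : realType) (d : nat) (Z : finType)
    (theta : Z -> 'cV[R[i]]_d) (Y : finType) (n : nat)
    (E : obsalg R Y n -> obsalg R unit d) : \bar R :=
  ereal_inf [set delta (ideal_meas theta) (E \o P \o ideal_meas theta)
            | P in [set P : obsalg R unit d -> obsalg R Y n | channel P]].

(* The measurement of X is an instrument with no quantum output, i.e. n = 1. *)
Definition complementarity (R : realType) (d : nat) (X Z : finType)
    (phi : X -> 'cV[R[i]]_d) (theta : Z -> 'cV[R[i]]_d) : \bar R :=
  meas_disturbance theta (ideal_meas phi).

(* Main.v *)
(* Compose the error-minimising postprocessing and the disturbance-minimising
   recovery with the instrument: the result is a joint POVM M_xz whose first
   marginal is close to the measurement of X and whose second marginal is close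
   to that of Z.  Both inequalities then follow, with the roles of X and Z
   exchanged, from one statement about joint POVMs: if the first marginal is at
   distance at most e from the projections P_x = |phi_x><phi_x|, some stochastic
   T(z|x) makes sum_x T(z|x) P_x at distance at most sqrt(2(e+s)) from the second
   marginal, for every s > 0.

   To find T, write M_xz = A_xz^* A_xz, so that W = (A_xz) is a Stinespring
   isometry of the joint measurement, and compare it with the maps
   sum |y_xz><phi_x| whose vectors satisfy sum_z |y_xz|^2 <= 1; these implement
   first measuring X and then drawing z.  For a fixed state rho, Uhlmann's
   theorem is explicit because P_x has rank one: y_xz proportional to
   A_xz rho phi_x gives the overlap sum_x sqrt(<phi_x|rho M_x rho|phi_x>), which
   the Fuchs-van de Graaf argument bounds below by 1 - e.  A bilinear minimax
   argument makes the choice of y independent of rho, and the distance of two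
   channels is at most the norm distance of their Stinespring isometries. *)

Require Import Defs.
From HB Require Import structures.
From mathcomp Require Import all_boot all_order all_algebra.
From mathcomp Require Import complex.
From mathcomp Require Import all_classical all_reals all_analysis.
From mathcomp Require Import sesquilinear spectral mxtens ring lra.

Set Implicit Arguments.
Unset Strict Implicit.
Unset Printing Implicit Defensive.

Import Order.TTheory GRing.Theory Num.Theory.

Local Open Scope ring_scope.
Local Open Scope sesquilinear_scope.

(** * Hilbert-Schmidt norm and positive semidefinite matrices *)

Section HilbertSchmidt.
Variable C : numClosedFieldType.

(* The squared Hilbert-Schmidt norm, i.e. |v|^2 for a column vector v. *)
Definition hsn m n (A : 'M[C]_(m, n)) : C := \tr (A ^t* *m A).

Definition psd n (A : 'M[C]_n) : Prop :=
  forall v : 'cV[C]_n, 0 <= (v ^t* *m A *m v) 0 0.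

Lemma adjM m n p (A : 'M[C]_(m, n)) (B : 'M[C]_(n, p)) :
  (A *m B) ^t* = B ^t* *m A ^t*.
Proof. by rewrite trmx_mul map_mxM. Qed.

Lemma adjD m n (A B : 'M[C]_(m, n)) : (A + B) ^t* = A ^t* + B ^t*.
Proof. by rewrite linearD /= map_mxD. Qed.

Lemma adjN m n (A : 'M[C]_(m, n)) : (- A) ^t* = - A ^t*.
Proof. by rewrite linearN /= map_mxN. Qed.

Lemma adjB m n (A B : 'M[C]_(m, n)) : (A - B) ^t* = A ^t* - B ^t*.
Proof. by rewrite adjD adjN. Qed.

Lemma adjZ m n (c : C) (A : 'M[C]_(m, n)) : (c *: A) ^t* = c^* *: A ^t*.
Proof. by rewrite linearZ /= map_mxZ. Qed.

Lemma adj_sum m n (I : finType) (P : pred I) (F : I -> 'M[C]_(m, n)) :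
  (\sum_(i | P i) F i) ^t* = \sum_(i | P i) (F i) ^t*.
Proof. by rewrite linear_sum /= raddf_sum. Qed.

Lemma adj1 n : (1%:M : 'M[C]_n) ^t* = 1%:M.
Proof. by rewrite trmx1 map_mx1. Qed.

Lemma adj0 m n : (0 : 'M[C]_(m, n)) ^t* = 0.
Proof. by rewrite trmx0 map_mx0. Qed.

Lemma mxtrace_adj n (A : 'M[C]_n) : \tr (A ^t* ) = (\tr A)^*.
Proof. by rewrite /mxtrace rmorph_sum; apply: eq_bigr => i _; rewrite !mxE. Qed.

Lemma mxtraceB n (A B : 'M[C]_n) : \tr (A - B) = \tr A - \tr B.
Proof. exact: raddfB. Qed.

Lemma mxtrace11 (A : 'M[C]_1) : \tr A = A 0 0.
Proof. by rewrite /mxtrace big_ord1. Qed.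

Lemma hsnE m n (A : 'M[C]_(m, n)) : hsn A = \sum_j \sum_i `|A i j| ^+ 2.
Proof.
rewrite /hsn /mxtrace; apply: eq_bigr => j _; rewrite !mxE.
by apply: eq_bigr => i _; rewrite !mxE normCK mulrC.
Qed.

Lemma hsn_ge0 m n (A : 'M[C]_(m, n)) : 0 <= hsn A.
Proof.
by rewrite hsnE; do 2!apply: sumr_ge0 => ? _; rewrite exprn_ge0.
Qed.

Lemma hsn_eq0 m n (A : 'M[C]_(m, n)) : (hsn A == 0) = (A == 0).
Proof.
apply/idP/eqP => [|->]; last by rewrite /hsn mulmx0 mxtrace0.
rewrite hsnE psumr_eq0 => [/allP h|j _]; last first.
  by apply: sumr_ge0 => i _; rewrite exprn_ge0.
apply/matrixP => i j; rewrite mxE; apply/eqP.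
have := h j (mem_index_enum j); rewrite /= psumr_eq0 => [/allP h'|k _].
  by have := h' i (mem_index_enum i); rewrite /= expf_eq0 /= normr_eq0.
by rewrite exprn_ge0.
Qed.

Lemma hsn_col m n (A : 'M[C]_(m, n)) : hsn A = \sum_j hsn (col j A).
Proof.
rewrite hsnE; apply: eq_bigr => j _; rewrite hsnE big_ord1.
by apply: eq_bigr => i _; rewrite mxE.
Qed.

Lemma hsn_tr m n (A : 'M[C]_(m, n)) : hsn A^T = hsn A.
Proof.
rewrite !hsnE exchange_big.
by do 2!apply: eq_bigr => ? _; rewrite mxE.
Qed.

Lemma hsnZ m n (c : C) (A : 'M[C]_(m, n)) : hsn (c *: A) = `|c| ^+ 2 * hsn A.
Proof.
by rewrite /hsn adjZ -scalemxAl -scalemxAr !mxtraceZ mulrA normCK (mulrC c).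
Qed.

Lemma hsnB m n (A B : 'M[C]_(m, n)) :
  hsn (A - B) = hsn A + hsn B - (\tr (A ^t* *m B) + \tr (B ^t* *m A)).
Proof.
rewrite /hsn adjB mulmxBl !mulmxBr !mxtraceD !raddfN /= mxtraceD !raddfN /=.
ring.
Qed.

Lemma psdE n (A : 'M[C]_n) (v : 'cV[C]_n) :
  (v ^t* *m A *m v) 0 0 = \tr (v ^t* *m A *m v).
Proof. by rewrite mxtrace11. Qed.

Lemma psd_tr n k (A : 'M[C]_n) (V : 'M[C]_(n, k)) :
  psd A -> 0 <= \tr (V ^t* *m A *m V).
Proof.
move=> A0; rewrite /mxtrace; apply: sumr_ge0 => j _.
have := A0 (col j V); congr (_ <= _); rewrite !mxE.
apply: eq_bigr => i _; rewrite !mxE; congr (_ * _).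
by apply: eq_bigr => l _; rewrite !mxE.
Qed.

Lemma psd_gram m n (B : 'M[C]_(m, n)) : psd (B ^t* *m B).
Proof.
by move=> v; rewrite psdE -mulmxA -mulmxA mulmxA -adjM; apply: hsn_ge0.
Qed.

Lemma psdD n (A B : 'M[C]_n) : psd A -> psd B -> psd (A + B).
Proof.
by move=> A0 B0 v; rewrite mulmxDr mulmxDl mxE addr_ge0.
Qed.

Lemma psdZ n (c : C) (A : 'M[C]_n) : 0 <= c -> psd A -> psd (c *: A).
Proof.
by move=> c0 A0 v; rewrite -scalemxAr -scalemxAl mxE mulr_ge0.
Qed.

Lemma psd0 n : psd (0 : 'M[C]_n).
Proof. by move=> v; rewrite mulmx0 mul0mx mxE. Qed.

Lemma psd_sum n (I : finType) (P : pred I) (F : I -> 'M[C]_n) :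
  (forall i, P i -> psd (F i)) -> psd (\sum_(i | P i) F i).
Proof. by move=> F0; elim/big_ind: _ => //; [exact: psd0 | exact: psdD]. Qed.

(** A nonnegative form takes real values; at [e_i + c e_j] this makes [c A_ij + c^* A_ji] real for
    every [c]. *)
Lemma psd_herm n (A : 'M[C]_n) : psd A -> A ^t* = A.
Proof.
move=> A0; apply/matrixP => i j; rewrite !mxE.
pose f (u v : 'cV[C]_n) := (u ^t* *m A *m v) 0 0.
have fE k l : f (delta_mx k 0) (delta_mx l 0) = A k l.
  rewrite /f trmx_delta map_delta_mx -rowE -colE !mxE //.
have real u : f u u \is Num.real by apply: ger0_real; apply: A0.
have fD (c : C) : f (delta_mx i 0 + c *: delta_mx j 0)
    (delta_mx i 0 + c *: delta_mx j 0) =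
    A i i + `|c| ^+ 2 * A j j + (c * A i j + c^* * A j i).
  have fDl u u' v : f (u + u') v = f u v + f u' v.
    by rewrite /f adjD !mulmxDl mxE.
  have fDr u v v' : f u (v + v') = f u v + f u v' by rewrite /f mulmxDr mxE.
  have fZl a u v : f (a *: u) v = a^* * f u v.
    by rewrite /f adjZ -!scalemxAl mxE.
  have fZr a u v : f u (a *: v) = a * f u v by rewrite /f -scalemxAr mxE.
  rewrite !fDl !fDr !fZl !fZr !fE normCK; ring.
(* Polarisation with c = 1 and c = 'i. *)
have cross (c : C) : c * A i j + c^* * A j i \is Num.real.
  have := real (delta_mx i 0 + c *: delta_mx j 0); rewrite fD => h.
  have d k : A k k \is Num.real by rewrite -fE.
  have hd : A i i + `|c| ^+ 2 * A j j \is Num.real.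
    by rewrite rpredD ?rpredM ?rpredX ?normr_real.
  by rewrite -[X in X \is _](addKr (A i i + `|c| ^+ 2 * A j j)) rpredD ?rpredN.
have h1 := cross 1; have h2 := cross 'i.
move: h1 h2; rewrite conjC1 !mul1r conjCi => /CrealP; rewrite rmorphD /= => h1.
move=> /CrealP; rewrite rmorphD !rmorphM /= rmorphN /= conjCi => h2.
have h3 : (A i j)^* + (A j i)^* - A i j = A j i by rewrite h1; ring.
have i0 : 'i != 0 :> C by rewrite neq0Ci.
have h4 : - (A i j)^* + (A j i)^* = A i j - A j i.
  apply: (mulfI i0); move: h2.
  have -> : - 'i * (A i j)^* + - - 'i * (A j i)^* = 'i * (- (A i j)^* + (A j i)^* ).
    by ring.
  move=> ->; ring.
have : 2 * (A j i)^* = 2 * A i j.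
  have -> : 2 * (A j i)^* = ((A i j)^* + (A j i)^* ) + (- (A i j)^* + (A j i)^* ).
    by ring.
  by rewrite h1 h4; ring.
by apply: mulfI; rewrite pnatr_eq0.
Qed.

(** * Spectral decomposition, square roots, positive and negative parts *)

Lemma spectral n (A : 'M[C]_n) : A ^t* = A ->
  exists (U : 'M[C]_n) (l : 'rV[C]_n), [/\ U ^t* *m U = 1%:M, U *m U ^t* = 1%:M,
    forall i, l 0 i \is Num.real & A = U ^t* *m diag_mx l *m U].
Proof.
move=> hA; have hs : A \is hermsymmx.
  by apply/is_hermitianmxP; rewrite expr0 scale1r.
have Uu := spectral_unitarymx A.
exists (spectralmx A), (spectral_diag A); split.
- by have := mulVmx (spectral_unit A); rewrite invmx_unitary.
- by apply/unitarymxP.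
- by move=> i; have /mxOverP := hermitian_spectral_diag_real hs; apply.
have /hermitian_normalmx/orthomx_spectralP {1}-> := hs.
by rewrite invmx_unitary.
Qed.

Lemma psd_diag n (U : 'M[C]_n) (l : 'rV[C]_n) : (forall i, 0 <= l 0 i) ->
  exists B : 'M[C]_n, U ^t* *m diag_mx l *m U = B ^t* *m B.
Proof.
move=> l0; exists (diag_mx (\row_i sqrtC (l 0 i)) *m U).
rewrite adjM !mulmxA; congr (_ *m _); rewrite -!mulmxA; congr (_ *m _).
rewrite tr_diag_mx map_diag_mx mulmx_diag; congr diag_mx.
apply/rowP => i; rewrite !mxE /= geC0_conj ?sqrtC_ge0 //.
by rewrite -expr2 sqrtCK.
Qed.

Lemma psd_factor n (A : 'M[C]_n) : psd A -> exists B : 'M[C]_n, A = B ^t* *m B.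
Proof.
move=> A0; have [U [l [U1 U2 _ AE]]] := spectral (psd_herm A0).
rewrite AE; apply: psd_diag => i.
have e : U *m A *m U ^t* = diag_mx l.
  by rewrite AE !mulmxA U2 mul1mx -mulmxA U2 mulmx1.
have := A0 (U ^t* *m delta_mx i 0); rewrite adjM trmxCK !mulmxA.
rewrite -(mulmxA _ U A) -(mulmxA _ (U *m A)) e.
by rewrite trmx_delta map_delta_mx -rowE -colE !mxE eqxx mulr1n.
Qed.

Lemma tr_psd_ge0 n (A B : 'M[C]_n) : psd A -> psd B -> 0 <= \tr (A *m B).
Proof.
move=> /psd_factor[K ->] B0; rewrite mxtrace_mulC mulmxA mxtrace_mulC mulmxA.
by have := psd_tr (K ^t* ) B0; rewrite trmxCK.
Qed.

(** Jordan decomposition, by splitting the eigenvalues. The last clause bounds the largest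
    eigenvalue of [D] by its Hilbert-Schmidt norm; it turns a small potential in [minimax] into an
    operator inequality. *)
Lemma posneg n (H : 'M[C]_n) : H ^t* = H -> exists D Q : 'M[C]_n,
  [/\ psd D, psd Q, H = D - Q, \tr (D *m Q) = 0 &
    forall s : C, 0 <= s -> \tr (D *m D) <= s ^+ 2 -> psd (s%:M - D)].
Proof.
move=> /spectral[U [l [U1 U2 lr HE]]].
pose p := \row_i ((`|l 0 i| + l 0 i) / 2).
pose q := \row_i ((`|l 0 i| - l 0 i) / 2).
have p0 i : 0 <= p 0 i.
  by rewrite mxE divr_ge0 // addrC -lerBlDl sub0r -(normrN (l 0 i)) real_ler_norm ?rpredN.
have q0 i : 0 <= q 0 i by rewrite mxE divr_ge0 // subr_ge0 real_ler_norm.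
have UdU (a b : 'rV[C]_n) : (U ^t* *m diag_mx a *m U) *m (U ^t* *m diag_mx b *m U)
    = U ^t* *m diag_mx (\row_i (a 0 i * b 0 i)) *m U.
  rewrite -!mulmxA; congr (_ *m _); rewrite !mulmxA; congr (_ *m _).
  rewrite -(mulmxA _ U) U2 mulmx1 mulmx_diag; congr diag_mx.
have trU (a : 'rV[C]_n) : \tr (U ^t* *m diag_mx a *m U) = \sum_i a 0 i.
  by rewrite mxtrace_mulC mulmxA U2 mul1mx mxtrace_diag.
have ps (a : 'rV[C]_n) : (forall i, 0 <= a 0 i) -> psd (U ^t* *m diag_mx a *m U).
  by move=> /(psd_diag U)[B ->]; apply: psd_gram.
exists (U ^t* *m diag_mx p *m U), (U ^t* *m diag_mx q *m U); split.
- exact: ps.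
- exact: ps.
- rewrite HE -mulmxBl -mulmxBr -raddfB /=; congr (_ *m diag_mx _ *m _).
  by apply/rowP => i; rewrite !mxE; field.
- rewrite UdU trU big1 // => i _; rewrite !mxE.
  have -> : (`|l 0 i| + l 0 i) / 2 * ((`|l 0 i| - l 0 i) / 2) =
     (`|l 0 i| ^+ 2 - l 0 i ^+ 2) / 4 by field.
  by rewrite real_normK // subrr mul0r.
move=> s s0; rewrite UdU trU => hs.
have ps_s i : p 0 i <= s.
  rewrite -(ler_pXn2r (n:=2)) // ?nnegrE //; apply: le_trans hs.
  rewrite (bigD1 i) //= mxE -expr2 lerDl.
  by apply: sumr_ge0 => j _; rewrite mxE mulr_ge0.
have -> : s%:M = U ^t* *m diag_mx (const_mx s) *m U.
  by rewrite diag_const_mx mul_mx_scalar -scalemxAl U1 scalemx1.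
rewrite -mulmxBl -mulmxBr -raddfB /=; apply: ps => i.
by rewrite 2!mxE (mxE _ _ 0 i) subr_ge0.
Qed.
End HilbertSchmidt.

(** * A bilinear minimax theorem *)

(* No compactness is needed: while some B in S has tr ((c - B)_+ ^2) > s ^ 2,
   a step of fixed length t towards the best response to rho = (c - B)_+
   decreases this potential by at least t s ^ 2. *)
Lemma minimax (R : realType) (d : nat) (c b : R[i]) (S : 'M[R[i]]_d -> Prop) :
  c \is Num.real -> 0 <= b ->
  (exists B, S B) ->
  (forall B, S B -> [/\ B ^t* = B, psd (b%:M - B) & psd (b%:M + B)]) ->
  (forall t B B', 0 <= t <= 1 -> S B -> S B' -> S ((1 - t) *: B + t *: B')) ->
  (forall rho, psd rho -> exists2 B, S B & c * \tr rho <= \tr (rho *m B)) ->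
  forall s, 0 < s -> exists2 B, S B & psd (B - (c - s)%:M).
Proof.
move=> cr b0 [B0 SB0] bd cvx best s s0.
have cJ : c^* = c by apply/CrealP.
have herm B : S B -> (c%:M - B) ^t* = c%:M - B.
  by move=> /bd[hB _ _]; rewrite adjB hB tr_scalar_mx map_scalar_mx /= cJ.
(* [K] bounds [tr ((B' - B)^2)] on [S], because [-2b <= B' - B <= 2b] there; the summand [s ^ 2]
   keeps [K] positive and the step [t = s ^ 2 / K] at most 1. *)
pose K : R[i] := 4 * b ^+ 2 * d%:R + s ^+ 2.
have K0 : 0 < K by rewrite ltr_wpDl ?exprn_gt0 // !mulr_ge0 // exprn_ge0.
pose t : R[i] := s ^+ 2 / K.
have t0 : 0 < t by rewrite divr_gt0 // exprn_gt0.
have t1 : t <= 1.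
  by rewrite ler_pdivrMr // mul1r lerDr !mulr_ge0 // exprn_ge0.
have bdK B B' : S B -> S B' -> \tr ((B' - B) *m (B' - B)) <= K.
  move=> /bd[hB lB uB] /bd[hB' lB' uB'].
  have l : psd ((2 * b)%:M - (B' - B)).
    have -> : (2 * b)%:M - (B' - B) = (b%:M - B') + (b%:M + B).
      by rewrite mulr_natl mulr2n raddfD /= opprB addrACA addrC.
    exact: psdD.
  have u : psd ((2 * b)%:M + (B' - B)).
    have -> : (2 * b)%:M + (B' - B) = (b%:M + B') + (b%:M - B).
      by rewrite mulr_natl mulr2n raddfD /= addrACA.
    exact: psdD.
  move: (B' - B) l u => L l u.
  (* Expands [0 <= tr ((2b - L) (2b + L)) = 4 b^2 d - tr (L^2)]. *)
  have := tr_psd_ge0 l u; rewrite mulmxBl !mulmxDr.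
  rewrite !mul_scalar_mx mul_mx_scalar mxtraceB !mxtraceD !mxtraceZ.
  rewrite mxtrace_scalar -(mulr_natr _ d) => h.
  rewrite -subr_ge0; apply: le_trans h _; rewrite -subr_ge0 /K.
  set X := \tr L; set Y := \tr (L *m L).
  have -> : 4 * b ^+ 2 * d%:R + s ^+ 2 - Y -
    (2 * b * (2 * b * d%:R) + 2 * b * X - (2 * b * X + Y)) = s ^+ 2 by ring.
  by rewrite exprn_ge0 // ltW.
pose good (g : R[i]) := exists B D Q, [/\ S B, c%:M - B = D - Q,
  [/\ psd D, psd Q & \tr (D *m Q) = 0],
  (forall s : R[i], 0 <= s -> \tr (D *m D) <= s ^+ 2 -> psd (s%:M - D)) &
  \tr (D *m D) <= g].
have start B : S B -> exists2 g, good g & g \is Num.real.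
  move=> SB; have [D [Q [pD pQ E tDQ bD]]] := posneg (herm _ SB).
  exists (\tr (D *m D)); first by exists B, D, Q.
  by rewrite ger0_real // tr_psd_ge0.
have [//|none] := pselect (exists2 B, S B & psd (B - (c - s)%:M)).
have step g : good g -> good (g - t * s ^+ 2).
  move=> [B [D [Q [SB E [pD pQ tDQ] bD gD]]]].
  have gs : s ^+ 2 < \tr (D *m D).
    rewrite real_ltNge ?ger0_real ?tr_psd_ge0 ?exprn_ge0 ?(ltW s0) //.
    apply/negP => le_s; apply: none; exists B; first by [].
    have -> : B - (c - s)%:M = (s%:M - D) + Q.
      rewrite raddfB /= opprB addrCA -[B - c%:M]opprB E opprB.
      by rewrite (addrC Q) addrA.
    by apply: psdD; [apply: bD le_s; apply: ltW | exact: pQ].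
  have [B' SB' hB'] := best D pD.
  pose B2 := (1 - t) *: B + t *: B'.
  have SB2 : S B2 by apply: cvx; rewrite // (ltW t0) t1.
  have [D2 [Q2 [pD2 pQ2 E2 tDQ2 bD2]]] := posneg (herm _ SB2).
  exists B2, D2, Q2; split=> //.
  pose L := B' - B.
  have E3 : D2 + (Q - Q2) = D - t *: L.
    rewrite addrCA -[D2 - Q2]E2 /B2 /L scalerBl scale1r.
    have -> : B = c%:M - (D - Q) by rewrite -E opprB addrC subrK.
    rewrite !scalerBr; apply/matrixP => i j; rewrite !mxE; ring.
  (* Since [tr (D Q) = 0], [tr (D^2) = tr (D (c - B))], and the response [B'] to [D] satisfies
     [c tr D <= tr (D B')]. *)
  have tL : \tr (D *m D) <= \tr (D *m L).
    have -> : \tr (D *m D) = \tr (D *m (c%:M - B)).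
      by rewrite E mulmxBr mxtraceB tDQ subr0.
    rewrite /L !mulmxBr !mxtraceB mul_mx_scalar mxtraceZ lerD2r //.
  (* With [G = Q - Q2], [D - t L = D2 + G]. The cross term [tr (D2 G)] equals [tr (D2 Q) >= 0]
     because [tr (D2 Q2) = 0], so passing from [D2] to [D - t L] cannot decrease the Hilbert-Schmidt
     norm. *)
  have low : \tr (D2 *m D2) <= \tr ((D - t *: L) *m (D - t *: L)).
    have [G EG] : exists G, G = Q - Q2 by exists (Q - Q2).
    rewrite -E3 -EG mulmxDl !mulmxDr !mxtraceD -addrA lerDl.
    rewrite (mxtrace_mulC G D2) addrA addr_ge0 //.
      by rewrite EG mulmxBr mxtraceB tDQ2 subr0 addr_ge0 // tr_psd_ge0.
    have : G ^t* = G by rewrite EG adjB !psd_herm.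
    by move=> {1}<-; apply: hsn_ge0.
  apply: le_trans low _.
  rewrite mulmxBl !mulmxBr !mxtraceB -!scalemxAl -!scalemxAr !mxtraceZ.
  rewrite (mxtrace_mulC L).
  have hK := bdK _ _ SB SB'; rewrite -/L in hK.
  set X := \tr (D *m D) in gD gs tL *; set Y := \tr (D *m L) in tL *.
  set Z := \tr (L *m L) in hK *.
  have tK : t * K = s ^+ 2 by rewrite mulfVK // gt_eqF.
  have h1 : t * (t * Z) <= t * s ^+ 2.
    by rewrite ler_pM2l // -tK ler_pM2l.
  have h2 : t * s ^+ 2 <= t * Y.
    by rewrite ler_pM2l // (le_trans _ tL) // ltW.
  rewrite -subr_ge0.
  have -> : g - t * s ^+ 2 - (X - t * Y - (t * Y - t * (t * Z))) =
    (g - X) + 2 * (t * Y - t * s ^+ 2) + (t * s ^+ 2 - t * (t * Z)) by ring.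
  apply: addr_ge0; last by rewrite subr_ge0.
  by apply: addr_ge0; rewrite ?mulr_ge0 // subr_ge0.
have [g gg gr] := start _ SB0.
have iter k : good (g - k%:R * (t * s ^+ 2)).
  elim: k => [|k IH]; first by rewrite mul0r subr0.
  by rewrite -natr1 mulrDl mul1r opprD addrA; apply: step.
(* The potential stays nonnegative yet drops by the fixed [e > 0] at each iteration; the archimedean
   property of the real parts excludes this. *)
exfalso; set e := t * s ^+ 2 in iter.
have e0 : 0 < e by rewrite mulr_gt0 // exprn_gt0.
have pos k : k%:R * e <= g.
  have [B [D [Q [_ _ [pD _ _] _ h]]]] := iter k.
  by rewrite -subr_ge0; apply: le_trans h; apply: tr_psd_ge0.
have eR : e = (complex.Re e)%:C%C by rewrite RRe_real // gtr0_real.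
have gR : g = (complex.Re g)%:C%C by rewrite RRe_real.
have eR0 : 0 < complex.Re e by rewrite -ltcR -eR.
have := pos (Num.bound (complex.Re g / complex.Re e)).
rewrite eR gR -(rmorph_nat (real_complex R)) -rmorphM lecR leNgt => /negP; apply.
rewrite -ltr_pdivrMr //; apply: archi_boundP.
apply: divr_ge0; last exact: ltW.
by rewrite -ler0c -gR; have := pos 0%N; rewrite mul0r.
Qed.

(** * Completely bounded distance from Stinespring dilations *)

Section Dilation.
Variable C : numClosedFieldType.

Definition contraction k (a : 'M[C]_k) : Prop :=
  forall g : 'cV[C]_k, hsn (a *m g) <= hsn g.

(** With [U] and [V] read as vectors of [C^k (x) C^d], this is the matrix element of
    [sum_z a_z (x) D_z] between them. The factor on [C^k] acts from the right by its transpose,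
    hence [(a z)^T]. *)
Definition cbform (Z : finType) d k (D : Z -> 'M[C]_d) (a : Z -> 'M[C]_k)
    (U V : 'M[C]_(d, k)) : C :=
  \sum_z \tr ((a z)^T *m (U ^t* *m D z *m V)).

(* U and V stand for vectors of C^k (x) C^d.  The arithmetic mean of the squared
   norms may replace their geometric mean |U| |V| by homogeneity. *)
Definition cb_bounded (Z : finType) d (D : Z -> 'M[C]_d) (c : C) : Prop :=
  forall k (a : Z -> 'M[C]_k) (U V : 'M[C]_(d, k)), (forall z, contraction (a z)) ->
    `|cbform D a U V| <= c * (hsn U + hsn V) / 2.

(** Cauchy-Schwarz in Young's form: expand [hsn (l F - w H) >= 0] with the phase [w] such that
    [w z = |z|]. The weight [l] is free, to balance the two factors. *)
Lemma hs_le m n (F H : 'M[C]_(m, n)) (l : C) : 0 < l ->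
  `|\tr (F ^t* *m H)| <= (l * hsn F + l^-1 * hsn H) / 2.
Proof.
move=> l0; set z := \tr _; have lJ : l^* = l by rewrite geC0_conj // ltW.
have hF := hsn_ge0 F; have hH := hsn_ge0 H.
have [z0|z0] := eqVneq z 0.
  by rewrite z0 normr0 divr_ge0 // addr_ge0 // mulr_ge0 ?invr_ge0 // ltW.
pose w := `|z| / z.
have wz : w * z = `|z| by rewrite mulfVK.
have w1 : `|w| = 1 by rewrite normf_div normr_id divff // normr_eq0.
have := hsn_ge0 (l *: F - w *: H); rewrite hsnB !hsnZ w1 gtr0_norm // expr1n mul1r.
have -> : \tr ((w *: H) ^t* *m (l *: F)) = (\tr ((l *: F) ^t* *m (w *: H)))^*.
  by rewrite -mxtrace_adj adjM trmxCK.
rewrite adjZ -scalemxAl -scalemxAr !mxtraceZ -/z lJ wz.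
rewrite (@geC0_conj _ (l * _)) ?mulr_ge0 ?(ltW l0) // => h.
rewrite ler_pdivlMr // -(ler_pM2l l0).
have -> : l * (l * hsn F + l^-1 * hsn H) = l ^+ 2 * hsn F + hsn H.
  by field; rewrite gt_eqF.
rewrite -subr_ge0.
by apply: le_trans h _; rewrite le_eqVlt; apply/orP; left; apply/eqP; ring.
Qed.

Lemma contr_hsn k m (a : 'M[C]_k) (G : 'M[C]_(m, k)) :
  contraction a -> hsn (G *m a^T) <= hsn G.
Proof.
move=> ca; rewrite -hsn_tr trmx_mul trmxK -(hsn_tr G) !(hsn_col (_ *m _)).
rewrite (hsn_col G^T); apply: ler_sum => j _.
by rewrite colE -mulmxA -colE.
Qed.

Lemma contr_le m k (a : 'M[C]_k) (F G : 'M[C]_(m, k)) (l : C) :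
  contraction a -> 0 < l ->
  `|\tr (a^T *m (F ^t* *m G))| <= (l * hsn F + l^-1 * hsn G) / 2.
Proof.
move=> ca l0; rewrite mxtrace_mulC -mulmxA; apply: le_trans (hs_le _ _ l0) _.
rewrite ler_pM2r ?invr_gt0 // lerD2l ler_pM2l ?invr_gt0 //.
exact: contr_hsn.
Qed.

Lemma sum_hsn_mul (J : finType) m d k (K : J -> 'M[C]_(m, d)) (U : 'M[C]_(d, k))
    (c : C) :
  psd (c%:M - \sum_j (K j) ^t* *m K j) -> \sum_j hsn (K j *m U) <= c * hsn U.
Proof.
move=> /(psd_tr U); rewrite mulmxBr mulmxBl mxtraceB mul_mx_scalar -scalemxAl.
rewrite mxtraceZ subr_ge0; congr (_ <= _).
rewrite mulmx_sumr mulmx_suml raddf_sum; apply: eq_bigr => j _ /=.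
by rewrite /hsn adjM !mulmxA.
Qed.

(* K^*K - L^*L = (K - L)^*K + L^*(K - L), and each half contributes c. *)
Lemma cb_bounded_dilation (J Z : finType) m d (lab : J -> Z) (K L : J -> 'M[C]_(m, d))
    (c : C) : 0 < c ->
  \sum_j (K j) ^t* *m K j = 1%:M -> \sum_j (L j) ^t* *m L j = 1%:M ->
  psd ((c ^+ 2)%:M - \sum_j (K j - L j) ^t* *m (K j - L j)) ->
  cb_bounded (fun z => \sum_(j | lab j == z) ((K j) ^t* *m K j - (L j) ^t* *m L j))
    (2 * c).
Proof.
move=> c0 K1 L1 KL k a U V ca.
pose F (N : J -> 'M[C]_(m, d)) W j := N j *m W : 'M[C]_(m, k).
pose KmL j := K j - L j.
have -> : cbform (fun z => \sum_(j | lab j == z)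
      ((K j) ^t* *m K j - (L j) ^t* *m L j)) a U V =
    \sum_j (\tr ((a (lab j))^T *m ((F KmL U j) ^t* *m F K V j)) +
            \tr ((a (lab j))^T *m ((F L U j) ^t* *m F KmL V j))).
  rewrite /cbform [RHS](partition_big lab predT) //=; apply: eq_bigr => z _.
  rewrite mulmx_sumr mulmx_suml mulmx_sumr raddf_sum.
  apply: eq_bigr => j /eqP -> /=.
  have -> : (K j) ^t* *m K j - (L j) ^t* *m L j =
      (KmL j) ^t* *m K j + (L j) ^t* *m KmL j.
    by rewrite adjB mulmxBl mulmxBr addrA subrK.
  by rewrite -mxtraceD -mulmxDr /F !adjM mulmxDr mulmxDl !mulmxA.
apply: le_trans (ler_norm_sum _ _ _) _.
have bK U' : \sum_j hsn (F KmL U' j) <= c ^+ 2 * hsn U' by apply: sum_hsn_mul.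
have b1 (N : J -> 'M[C]_(m, d)) U' : \sum_j (N j) ^t* *m N j = 1%:M ->
    \sum_j hsn (F N U' j) <= hsn U'.
  move=> N1; rewrite -[leRHS]mul1r; apply: sum_hsn_mul; rewrite N1 subrr.
  exact: psd0.
(* The weights balance: [K - L] carries [c^-1] and its sums are at most [c^2 |U|^2] or [c^2 |V|^2],
   the isometries carry [c], so each of the four terms sums to at most [c |U|^2 / 2] or
   [c |V|^2 / 2]. *)
pose G j := (c^-1 * hsn (F KmL U j) + c * hsn (F K V j)) / 2 +
            (c * hsn (F L U j) + c^-1 * hsn (F KmL V j)) / 2.
have : \sum_j G j <= 2 * c * (hsn U + hsn V) / 2.
  rewrite big_split -!mulr_suml !big_split /= -!mulr_sumr -mulrDl.
  rewrite ler_pM2r ?invr_gt0 //.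
  have cc x : c^-1 * (c ^+ 2 * x) = c * x.
    by rewrite expr2 -mulrA mulKf // gt_eqF.
  have h1 := bK U; have h2 := bK V; have h3 := b1 _ V K1; have h4 := b1 _ U L1.
  rewrite -(ler_pM2l (x := c^-1)) ?invr_gt0 // cc in h1.
  rewrite -(ler_pM2l (x := c^-1)) ?invr_gt0 // cc in h2.
  rewrite -(ler_pM2l c0) in h3; rewrite -(ler_pM2l c0) in h4.
  apply: le_trans (lerD (lerD h1 h3) (lerD h4 h2)) _.
  by rewrite le_eqVlt; apply/orP; left; apply/eqP; ring.
apply: le_trans; apply: ler_sum => j _; apply: le_trans (ler_normD _ _) _.
apply: lerD; last exact: contr_le.
by rewrite -{2}(invrK c); apply: contr_le; rewrite ?invr_gt0.
Qed.
End Dilation.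

(** * Fuchs-van de Graaf bound on the fidelity *)

Lemma contr_unitary (C : numClosedFieldType) k (a : 'M[C]_k) :
  a ^t* *m a = 1%:M -> contraction a.
Proof.
by move=> a1 g; rewrite /hsn adjM mulmxA -(mulmxA _ (a ^t* )) a1 mulmx1.
Qed.

(** If [rho = V V^*], then [V] is a purification, and the two measurements leave the reference
    system in the unnormalised states [V^* P_x V], of rank one, and [V^* M_x V]. The square root is
    their fidelity. Testing the distance on [V] bounds the loss of fidelity by [e tr rho]. *)
Lemma fidelity_sum (C : numClosedFieldType) (X : finType) d (phi : X -> 'cV[C]_d)
    (M : X -> 'M[C]_d) (e : C) (rho : 'M[C]_d) :
  \sum_x phi x *m (phi x) ^t* = 1%:M -> (forall x, psd (M x)) ->
  \sum_x M x = 1%:M -> cb_bounded (fun x => phi x *m (phi x) ^t* - M x) (2 * e) ->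
  psd rho ->
  (1 - e) * \tr rho <=
    \sum_x sqrtC (\tr ((rho *m phi x) ^t* *m M x *m (rho *m phi x))).
Proof.
move=> phi1 M0 M1 cb rho0; have [B rhoE] := psd_factor rho0.
pose V := B ^t*; have rhoV : rho = V *m V ^t* by rewrite /V trmxCK.
pose s x := V ^t* *m phi x; pose p x := hsn (s x).
pose h x := sqrtC (\tr ((rho *m phi x) ^t* *m M x *m (rho *m phi x))).
have p0 x : 0 <= p x by apply: hsn_ge0.
have hh0 x : 0 <= \tr ((rho *m phi x) ^t* *m M x *m (rho *m phi x)).
  exact: psd_tr.
have h0 x : 0 <= h x by rewrite sqrtC_ge0.
have sump : \sum_x p x = \tr rho.
  rewrite -[rho in RHS]mulmx1 -phi1 mulmx_sumr raddf_sum.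
  apply: eq_bigr => x _ /=; rewrite /p /hsn /s adjM trmxCK rhoV.
  by rewrite [RHS]mxtrace_mulC -!mulmxA [RHS]mxtrace_mulC !mulmxA.
(* The test observables 2 q x - 1, where q x projects onto V^* phi_x as long as
   the overlap h x does not exceed p x and vanishes otherwise: the remaining x
   only increase the sum of the h x. *)
pose sel x := (0 < p x) && (h x <= p x).
pose q x := if sel x then (p x)^-1 *: (s x *m (s x) ^t* ) else 0.
pose a x := (2 *: q x - 1%:M)^T.
have qJ x : (q x) ^t* = q x.
  rewrite /q; case: ifP => _; last by rewrite adj0.
  by rewrite adjZ adjM trmxCK geC0_conj // invr_ge0.
have ss x : (s x) ^t* *m s x = (p x)%:M.
  by rewrite [LHS]mx11_scalar -mxtrace11.
have qq x : q x *m q x = q x.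
  rewrite /q; case: ifP => [/andP[px _]|_]; last by rewrite mulmx0.
  rewrite -scalemxAl -scalemxAr mulmxA -(mulmxA (s x)) ss mul_mx_scalar.
  by rewrite -scalemxAl !scalerA mulVf ?gt_eqF // mulr1.
have ca x : contraction (a x).
  apply: contr_unitary; set b := 2 *: q x - 1%:M.
  have bJ : b ^t* = b by rewrite adjB adjZ qJ adj1 conjC_nat.
  have -> : (a x) ^t* *m a x = (b *m b ^t* )^T.
    by rewrite /a trmx_mul map_trmx !trmxK.
  rewrite bJ /b mulmxBr !mulmxBl !mulmx1 mul1mx -scalemxAl -scalemxAr qq scalerA.
  rewrite -[RHS]trmx1; congr _^T; apply/matrixP => i j; rewrite !mxE; ring.
have sE x : V ^t* *m (phi x *m (phi x) ^t* ) *m V = s x *m (s x) ^t*.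
  by rewrite /s adjM trmxCK !mulmxA.
have tq1 x : \tr (q x *m (V ^t* *m (phi x *m (phi x) ^t* ) *m V)) =
    if sel x then p x else 0.
  rewrite sE /q; case: ifP => [/andP[px _]|_]; last by rewrite mul0mx mxtrace0.
  rewrite -scalemxAl mulmxA -(mulmxA (s x)) ss mul_mx_scalar -scalemxAl.
  by rewrite scalerA mxtraceZ mulVf ?gt_eqF // mul1r mxtrace_mulC.
have tq2 x : \tr (q x *m (V ^t* *m M x *m V)) =
    if sel x then h x ^+ 2 / p x else 0.
  rewrite /q; case: ifP => [_|_]; last by rewrite mul0mx mxtrace0.
  rewrite -scalemxAl mxtraceZ mulrC; congr (_ * _).
  rewrite sqrtCK rhoV [LHS]mxtrace_mulC [in LHS]mulmxA [LHS]mxtrace_mulC /s.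
  by rewrite !adjM !trmxCK !mulmxA.
have hV : hsn V = \tr rho by rewrite /hsn mxtrace_mulC -rhoV.
have := cb _ a V V ca; rewrite hV.
have -> : cbform (fun x => phi x *m (phi x) ^t* - M x) a V V =
    2 * \sum_(x | sel x) (p x - h x ^+ 2 / p x).
  (* The summand [-1] of the test observables only meets [sum_x (P_x - M_x)], which is 0. *)
  have -> : cbform (fun x => phi x *m (phi x) ^t* - M x) a V V =
      2 * (\sum_x (\tr (q x *m (V ^t* *m (phi x *m (phi x) ^t* ) *m V))
        - \tr (q x *m (V ^t* *m M x *m V)))) -
      \tr (V ^t* *m (\sum_x (phi x *m (phi x) ^t* - M x)) *m V).
    rewrite mulmx_sumr mulmx_suml [\tr (\sum_x _)]raddf_sum mulr_sumr -sumrB; apply: eq_bigr => x _.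
    rewrite /a trmxK mulmxBl mul1mx mxtraceB -scalemxAl mxtraceZ /=.
    by congr (2 * _ - _); rewrite !mulmxBr mulmxBl mulmxBr mxtraceB.
  rewrite [\sum_x (_ - M x)]sumrB phi1 M1 subrr mulmx0 mul0mx mxtrace0 subr0; congr (2 * _).
  rewrite [RHS]big_mkcond; apply: eq_bigr => x _; rewrite tq1 tq2 /=.
  by case: ifP; rewrite ?subrr.
have selge x : sel x -> p x - h x <= p x - h x ^+ 2 / p x.
  move=> /andP[px hp]; rewrite lerD2l lerN2 ler_pdivrMr // expr2.
  by rewrite ler_wpM2l.
rewrite ger0_norm; last first.
  rewrite mulr_ge0 // sumr_ge0 // => x sx; apply: le_trans (selge x sx).
  by rewrite subr_ge0; case/andP: sx.
move=> bound.
have {bound} : \sum_(x | sel x) (p x - h x) <= e * \tr rho.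
  rewrite -(ler_pM2l (x := 2)) //.
  apply: le_trans (_ : 2 * \sum_(x | sel x) (p x - h x ^+ 2 / p x) <= _).
    by rewrite ler_pM2l //; apply: ler_sum.
  apply: le_trans bound _; rewrite le_eqVlt; apply/orP; left; apply/eqP.
  by field.
rewrite mulrBl mul1r lerBlDr -lerBlDl => bound.
apply: le_trans bound.
rewrite -sump -sumrB (bigID sel) /= gerDl sumr_le0 // => x.
rewrite /sel negb_and subr_le0 => /orP[px|hp].
  by have := p0 x; rewrite le_eqVlt (negbTE px) orbF => /eqP <-; apply: h0.
by apply: ltW; rewrite (real_ltNge (ger0_real (p0 x)) (ger0_real (h0 x))).
Qed.

(** * Joint measurements and postprocessings of an ideal measurement *)

Section Postprocessing.
Variables (R : realType) (X Z : finType) (d : nat).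
Local Notation C := R[i].
Variables (phi : X -> 'cV[C]_d) (A : X -> Z -> 'M[C]_d).
Local Notation P x := (phi x *m (phi x) ^t* ).
Hypothesis phi_on : forall x y, (phi x) ^t* *m phi y = ((x == y)%:R)%:M.
Hypothesis phi1 : \sum_x P x = 1%:M.
Hypothesis A1 : \sum_x \sum_z (A x z) ^t* *m A x z = 1%:M.

Let weight (y : X -> Z -> 'cV[C]_d) x := \sum_z hsn (y x z).
(** This is [V^* W] for the block columns [W = (A_xz)] and [V = (y_xz phi_x^* )]. Here
    [V^* V = sum_x weight(x) P_x], so [V] is a contraction when the weights are at most 1. *)
Let overlap (y : X -> Z -> 'cV[C]_d) :=
  \sum_x \sum_z phi x *m (y x z) ^t* *m A x z.

Lemma gram_kraus (u v : 'cV[C]_d) :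
  (u *m v ^t* ) ^t* *m (u *m v ^t* ) = hsn u *: (v *m v ^t* ).
Proof.
rewrite adjM trmxCK mulmxA -(mulmxA v) [u ^t* *m u]mx11_scalar -mxtrace11.
by rewrite mul_mx_scalar -scalemxAl.
Qed.

(** The first sum is the squared difference of the dilations [W] and [V], with [W^* W = 1]. The
    second is what [V] lacks to be an isometry; extra Kraus operators supply it in
    [postprocessing]. *)
Lemma overlap_gap (y : X -> Z -> 'cV[C]_d) :
  \sum_x \sum_z (A x z - y x z *m (phi x) ^t* ) ^t* *m
                (A x z - y x z *m (phi x) ^t* ) +
  \sum_x (1 - weight y x) *: P x = 2%:M - (overlap y + (overlap y) ^t* ).
Proof.
have -> : \sum_x (1 - weight y x) *: P x = 1%:M - \sum_x weight y x *: P x.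
  by rewrite -phi1 -sumrB; apply: eq_bigr => x _; rewrite scalerBl scale1r.
have -> : \sum_x \sum_z (A x z - y x z *m (phi x) ^t* ) ^t* *m
      (A x z - y x z *m (phi x) ^t* ) =
    1%:M - (overlap y + (overlap y) ^t* ) + \sum_x weight y x *: P x.
  rewrite /overlap adj_sum -A1 -!big_split -sumrB -big_split /=.
  apply: eq_bigr => x _; rewrite /weight scaler_suml adj_sum.
  rewrite -!big_split -sumrB -big_split /=; apply: eq_bigr => z _.
  rewrite -gram_kraus !adjB !adjM !trmxCK mulmxBl !mulmxBr !mulmxA.
  rewrite opprB opprD -!addrA; congr (_ + _).
  by rewrite [LHS]addrA [LHS]addrC.
by rewrite [X in _ + X = _]addrC addrA addrK addrAC -raddfD.
Qed.

Lemma overlap_le2 (y : X -> Z -> 'cV[C]_d) : (forall x, weight y x <= 1) ->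
  psd (2%:M - (overlap y + (overlap y) ^t* )).
Proof.
move=> y1; rewrite -overlap_gap; apply: psdD.
  by do 2!apply: psd_sum => ? _; apply: psd_gram.
apply: psd_sum => x _; apply: psdZ; first by rewrite subr_ge0.
by have := psd_gram ((phi x) ^t* ); rewrite trmxCK.
Qed.

(** Explicit Uhlmann: for each [x], Cauchy-Schwarz over [z] is saturated by [y_xz] parallel to
    [A_xz rho phi_x]. The overlap is then real, and the adjoint doubles it. *)
Lemma best_overlap (rho : 'M[C]_d) : psd rho ->
  exists2 y, forall x, weight y x <= 1 &
    \tr (rho *m (overlap y + (overlap y) ^t* )) =
    2 * \sum_x sqrtC (\tr ((rho *m phi x) ^t* *m
      (\sum_z (A x z) ^t* *m A x z) *m (rho *m phi x))).
Proof.
move=> rho0; have rhoJ := psd_herm rho0.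
pose h x := sqrtC (\tr ((rho *m phi x) ^t* *m
      (\sum_z (A x z) ^t* *m A x z) *m (rho *m phi x))).
have h2 x : h x ^+ 2 = \sum_z hsn (A x z *m (rho *m phi x)).
  rewrite sqrtCK mulmx_sumr mulmx_suml raddf_sum; apply: eq_bigr => z _ /=.
  by rewrite /hsn [in RHS]adjM !mulmxA.
have h0 x : 0 <= h x.
  rewrite sqrtC_ge0; apply: psd_tr; apply: psd_sum => z _; exact: psd_gram.
(* If [h x = 0] the inverse is 0 too, so [y x] vanishes and has weight 0 instead of 1. *)
pose y x z := (h x)^-1 *: (A x z *m (rho *m phi x)).
have hJ x : (h x)^-1^* = (h x)^-1 by rewrite geC0_conj // invr_ge0.
exists y.
  move=> x; rewrite /weight /y.
  under eq_bigr => z _ do rewrite hsnZ.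
  rewrite -mulr_sumr -h2 ger0_norm ?invr_ge0 // -exprMn.
  have [->|hx] := eqVneq (h x) 0; first by rewrite mulr0 expr0n.
  by rewrite mulVf // expr1n.
have tr1 : \tr (rho *m overlap y) = \sum_x h x.
  rewrite /overlap mulmx_sumr raddf_sum; apply: eq_bigr => x _ /=.
  rewrite mulmx_sumr raddf_sum /=.
  under eq_bigr => z _.
    rewrite mulmxA mulmxA mxtrace_mulC mulmxA mxtrace_mulC /y adjZ.
    rewrite -scalemxAl mxtraceZ hJ -/(hsn _); over.
  rewrite -mulr_sumr -h2; have [->|hx] := eqVneq (h x) 0.
    by rewrite expr0n mulr0.
  by rewrite expr2 mulKf.
rewrite mulmxDr mxtraceD tr1.
have -> : \tr (rho *m (overlap y) ^t* ) = (\tr (rho *m overlap y))^*.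
  by rewrite -mxtrace_adj adjM rhoJ mxtrace_mulC.
rewrite tr1 geC0_conj; last by apply: sumr_ge0.
by rewrite mulr_natl mulr2n.
Qed.

Lemma overlap_conv (t : C) (y y' : X -> Z -> 'cV[C]_d) : t \is Num.real ->
  overlap (fun x z => (1 - t) *: y x z + t *: y' x z) =
  (1 - t) *: overlap y + t *: overlap y'.
Proof.
move=> tr; have tJ : t^* = t by apply/CrealP.
have t1J : (1 - t)^* = 1 - t by apply/CrealP; rewrite rpredB ?real1.
rewrite /overlap !scaler_sumr -big_split; apply: eq_bigr => x _ /=.
rewrite !scaler_sumr -big_split; apply: eq_bigr => z _ /=.
rewrite adjD !adjZ mulmxDr mulmxDl -!scalemxAr -!scalemxAl tJ.
by rewrite t1J.
Qed.

(** The two sides differ by [t (1 - t) hsn (u - v)]. *)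
Lemma hsn_conv (t : C) (u v : 'cV[C]_d) : 0 <= t <= 1 ->
  hsn ((1 - t) *: u + t *: v) <= (1 - t) * hsn u + t * hsn v.
Proof.
move=> /andP[t0 t1]; rewrite -subr_ge0.
have -> : (1 - t) * hsn u + t * hsn v - hsn ((1 - t) *: u + t *: v) =
    t * (1 - t) * hsn (u - v).
  have -> : (1 - t) *: u + t *: v = (1 - t) *: u - (- t) *: v.
    by rewrite scaleNr opprK.
  have tJ : t^* = t by apply: geC0_conj.
  have t1J : (1 - t)^* = 1 - t by rewrite geC0_conj // subr_ge0.
  have ntJ : (- t)^* = - t by rewrite rmorphN /= tJ.
  have tN : `|t| = t by apply: ger0_norm.
  have t1N : `|1 - t| = 1 - t by apply: ger0_norm; rewrite subr_ge0.
  rewrite (hsnB u v) (hsnB (_ *: u)) (hsnZ _ u) (hsnZ _ v) normrN tN t1N.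
  rewrite !adjZ t1J ntJ -!scalemxAl -!scalemxAr !mxtraceZ; ring.
by rewrite !mulr_ge0 ?subr_ge0 ?hsn_ge0.
Qed.

(** Minimax with [c = 2 (1 - e)], [b = 2] and slack [2 s], over the sums of [overlap y] and its
    adjoint with weights at most 1. The responses to [rho] come from [best_overlap] and are
    estimated by [fidelity_sum]. *)
Lemma exists_overlap (e s : C) : 0 <= e -> 0 < s ->
  cb_bounded (fun x => P x - \sum_z (A x z) ^t* *m A x z) (2 * e) ->
  exists2 y, forall x, weight y x <= 1 &
    psd ((2 * (e + s))%:M - (2%:M - (overlap y + (overlap y) ^t* ))).
Proof.
move=> e0 s0 cb.
pose S B := exists2 y, forall x, weight y x <= 1 & B = overlap y + (overlap y) ^t*.
have s2 : 0 < 2 * s by rewrite mulr_gt0.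
have := @minimax R d (2 * (1 - e)) 2 S _ _ _ _ _ _ _ s2; case.
- by rewrite rpredM ?rpredB ?ger0_real.
- by [].
- exists (overlap (fun _ _ => 0) + (overlap (fun _ _ => 0)) ^t* ).
  exists (fun _ _ => 0) => // x; rewrite /weight big1 => [|z _]; first exact: ler01.
  by apply/eqP; rewrite hsn_eq0.
- move=> B [y y1 ->]; split; first by rewrite adjD trmxCK addrC.
    exact: overlap_le2.
  have -> : 2%:M + (overlap y + (overlap y) ^t* ) = 2%:M -
      (overlap (fun x z => - y x z) + (overlap (fun x z => - y x z)) ^t* ).
    have -> : overlap (fun x z => - y x z) = - overlap y.
      rewrite /overlap -sumrN; apply: eq_bigr => x _; rewrite -sumrN.
      by apply: eq_bigr => z _; rewrite adjN mulmxN mulNmx.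
    by rewrite adjN -opprD opprK.
  apply: overlap_le2 => x; apply: le_trans (y1 x); rewrite /weight.
  by apply: ler_sum => z _; rewrite -scaleN1r hsnZ normrN normr1 expr1n mul1r.
- move=> t B B' t01 [y y1 ->] [y' y1' ->].
  have tr : t \is Num.real by case/andP: t01 => t0 _; apply: ger0_real.
  exists (fun x z => (1 - t) *: y x z + t *: y' x z).
    move=> x; apply: le_trans (_ : (1 - t) * weight y x + t * weight y' x <= _).
      rewrite /weight !mulr_sumr -big_split; apply: ler_sum => z _.
      exact: hsn_conv.
    case/andP: t01 => t0 t1.
    rewrite -[leRHS](subrK t 1) lerD //; first by rewrite ler_piMr ?subr_ge0.
    by rewrite ler_piMr.
  have tJ : t^* = t by apply/CrealP.
  have t1J : (1 - t)^* = 1 - t by apply/CrealP; rewrite rpredB ?real1.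
  rewrite (overlap_conv _ _ tr) adjD !adjZ tJ t1J.
  by rewrite (scalerDr (1 - t)) (scalerDr t) addrACA.
- move=> rho rho0; have [y y1 yE] := best_overlap rho0.
  exists (overlap y + (overlap y) ^t* ); first by exists y.
  rewrite yE -mulrA (ler_pM2l (ltr0n _ 2)); apply: (fidelity_sum phi1 _ A1 cb rho0).
  by move=> x; apply: psd_sum => z _; apply: psd_gram.
move=> _ [y y1 ->] h; exists y; first exact: y1.
have -> : (2 * (e + s))%:M - (2%:M - (overlap y + (overlap y) ^t* )) =
   overlap y + (overlap y) ^t* - (2 * (1 - e) - 2 * s)%:M; last by [].
rewrite opprB addrCA; congr (_ + _); rewrite -!raddfB -raddfN /=.
by congr _%:M; ring.
Qed.

(** [T] draws [z] with probability [|y_xz|^2] and spends the missing weight [r x] on an auxiliary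
    distribution. The squared difference of the two dilations is then the gap of [exists_overlap],
    at most [2 (e + s)], and [cb_bounded_dilation] applies; [s > 0] keeps its constant positive. *)
Lemma postprocessing (e s : C) : 0 <= e -> 0 < s ->
  cb_bounded (fun x => P x - \sum_z (A x z) ^t* *m A x z) (2 * e) ->
  exists T : X -> Z -> C, [/\ forall x z, 0 <= T x z, forall x, \sum_z T x z = 1 &
    cb_bounded (fun z => \sum_x ((A x z) ^t* *m A x z - T x z *: P x))
      (2 * sqrtC (2 * (e + s)))].
Proof.
move=> e0 s0 cb; have [y y1 yb] := exists_overlap e0 s0 cb.
pose N z := \sum_x (A x z) ^t* *m A x z.
have N1 : \sum_z N z = 1%:M by rewrite exchange_big.
have phix x : hsn (phi x) = 1 by rewrite /hsn phi_on eqxx mxtrace_scalar.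
(* Any distribution could absorb the missing weight; the statistics of the second marginal in the
   state [phi x] exist without choosing an element of [Z]. *)
pose n x z := \tr ((phi x) ^t* *m N z *m phi x).
have n0 x z : 0 <= n x z.
  by apply: psd_tr; apply: psd_sum => x' _; apply: psd_gram.
have n1 x : \sum_z n x z = 1.
  transitivity (\tr ((phi x) ^t* *m (\sum_z N z) *m phi x)).
    by rewrite mulmx_sumr mulmx_suml raddf_sum.
  by rewrite N1 mulmx1 -/(hsn (phi x)) phix.
pose r x := 1 - weight y x.
have r0 x : 0 <= r x by rewrite subr_ge0.
exists (fun x z => hsn (y x z) + r x * n x z); split.
- by move=> x z; rewrite addr_ge0 ?hsn_ge0 // mulr_ge0.
- by move=> x; rewrite big_split -mulr_sumr n1 mulr1 /= addrC subrK.
(* The second copy of X * Z supplies the weight r x missing from y. *)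
pose K (j : X * Z + X * Z) := match j with
  | inl (x, z) => A x z | inr _ => 0 end.
pose L (j : X * Z + X * Z) := match j with
  | inl (x, z) => y x z *m (phi x) ^t*
  | inr (x, z) => (sqrtC (r x * n x z) *: phi x) *m (phi x) ^t* end.
pose lab (j : X * Z + X * Z) := match j with inl p => p.2 | inr p => p.2 end.
have Lr x z : hsn (sqrtC (r x * n x z) *: phi x) = r x * n x z.
  by rewrite hsnZ phix mulr1 ger0_norm ?sqrtCK // sqrtC_ge0 mulr_ge0.
have sumJ (F : X * Z + X * Z -> 'M[C]_d) : \sum_j F j =
    \sum_x \sum_z F (inl (x, z)) + \sum_x \sum_z F (inr (x, z)).
  by rewrite big_sumType /= !pair_bigA; congr (_ + _); apply: eq_bigr => -[].
(* [K] vanishes on the second copy, where [L] contributes [sum_x r x P_x], the defect term of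
   [overlap_gap]. *)
have gap : \sum_j (K j - L j) ^t* *m (K j - L j) =
    2%:M - (overlap y + (overlap y) ^t* ).
  rewrite -overlap_gap sumJ; congr (_ + _); apply: eq_bigr => x _.
  rewrite -/(r x) -[r x]mulr1 -(n1 x) mulr_sumr scaler_suml; apply: eq_bigr => z _.
  by rewrite /K /L sub0r adjN mulNmx mulmxN opprK gram_kraus Lr.
have K1 : \sum_j (K j) ^t* *m K j = 1%:M.
  rewrite sumJ A1 big1 ?addr0 // => x _; rewrite big1 // => z _.
  by rewrite mulmx0.
have L1 : \sum_j (L j) ^t* *m L j = 1%:M.
  rewrite sumJ -phi1 -big_split; apply: eq_bigr => x _ /=.
  under eq_bigr => z _ do rewrite gram_kraus.
  rewrite -scaler_suml -/(weight y x).
  under eq_bigr => z _ do rewrite gram_kraus Lr.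
  by rewrite -scaler_suml -mulr_sumr n1 mulr1 -scalerDl addrC subrK scale1r.
have c0 : 0 < sqrtC (2 * (e + s)).
  by rewrite sqrtC_gt0 mulr_gt0 // ltr_wpDl.
have DE : (fun z => \sum_(j | lab j == z) ((K j) ^t* *m K j - (L j) ^t* *m L j)) =
    (fun z => \sum_x ((A x z) ^t* *m A x z -
       (hsn (y x z) + r x * n x z) *: P x)).
  apply: funext => z; rewrite big_mkcond sumJ -big_split; apply: eq_bigr => x _ /=.
  transitivity (((A x z) ^t* *m A x z -
      (y x z *m (phi x) ^t* ) ^t* *m (y x z *m (phi x) ^t* )) +
    (0 - ((sqrtC (r x * n x z) *: phi x) *m (phi x) ^t* ) ^t* *m
      ((sqrtC (r x * n x z) *: phi x) *m (phi x) ^t* ))).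
    congr (_ + _); rewrite (bigD1 z) // eqxx /= big1.
    - by rewrite addr0.
    - by move=> z' /negbTE ->.
    - by rewrite addr0 mulmx0.
    - by move=> z' /negbTE ->.
  by rewrite sub0r !gram_kraus Lr scalerDl opprD addrA.
rewrite -DE; apply: cb_bounded_dilation; [exact: c0 | exact: K1 | exact: L1 |].
by rewrite gap sqrtCK.
Qed.
End Postprocessing.

(** * Amplified maps and operator norms *)

Section Amplification.
Variable R : realType.
Local Notation C := R[i].

(** Reshaping [C^k (x) C^m] into [m x k] matrices turns [1 (x) B] into left multiplication by [B]
    and the Euclidean norm into the Hilbert-Schmidt norm. *)
Definition slice k m (w : 'cV[C]_(k * m)) : 'M[C]_(m, k) :=
  \matrix_(p, i) w (mxtens_index (i, p)) 0.

Definition unslice k m (V : 'M[C]_(m, k)) : 'cV[C]_(k * m) :=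
  \col_l V (mxtens_unindex l).2 (mxtens_unindex l).1.

Lemma unsliceK k m : cancel (@unslice k m) (@slice k m).
Proof. by move=> V; apply/matrixP => p i; rewrite !mxE mxtens_indexK. Qed.

Lemma sum_mxtens (V : nmodType) k m (F : 'I_(k * m) -> V) :
  \sum_l F l = \sum_i \sum_p F (mxtens_index (i, p)).
Proof.
rewrite pair_bigA; apply: (reindex (fun q => mxtens_index (q.1, q.2))).
exists (@mxtens_unindex k m) => [[i p] _ | l _].
  by rewrite mxtens_indexK.
by rewrite -[RHS]mxtens_unindexK; case: mxtens_unindex.
Qed.

Lemma hsn_slice k m (w : 'cV[C]_(k * m)) : hsn (slice w) = hsn w.
Proof.
rewrite !hsnE big_ord1 sum_mxtens; do 2!apply: eq_bigr => ? _.
by rewrite mxE.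
Qed.

Lemma hsn_unslice k m (V : 'M[C]_(m, k)) : hsn (unslice V) = hsn V.
Proof. by rewrite -hsn_slice unsliceK. Qed.

Lemma amplE (Y Y' : finType) m m' k (T : obsalg R Y m -> obsalg R Y' m')
    (a : obsalg R Y (k * m)) y i p j q :
  ampl T a y (mxtens_index (i, p)) (mxtens_index (j, q)) =
  T (block a i j) y p q.
Proof.
rewrite ffunE summxE (bigD1 i) //= [X in _ + X]big1 ?addr0 => [|i' ne].
  rewrite summxE (bigD1 j) //= [X in _ + X]big1 ?addr0 => [|j' ne].
    by rewrite tensmxE mxE !eqxx mul1r.
  by rewrite tensmxE mxE (eq_sym j) (negbTE ne) andbF mul0r.
rewrite summxE big1 // => j' _.
by rewrite tensmxE mxE (eq_sym i) (negbTE ne) mul0r.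
Qed.

Lemma ampl_form (Y Y' : finType) m m' k (T : obsalg R Y m -> obsalg R Y' m')
    (a : obsalg R Y (k * m)) y (w w' : 'cV[C]_(k * m')) :
  (w ^t* *m ampl T a y *m w') 0 0 =
  \sum_i \sum_j ((slice w) ^t* *m T (block a i j) y *m slice w') i j.
Proof.
rewrite mxE sum_mxtens exchange_big /=.
under eq_bigr => q _ do under eq_bigr => j _ do rewrite mxE sum_mxtens mulr_suml.
rewrite exchange_big /=.
under eq_bigr => j _ do rewrite exchange_big /=.
rewrite exchange_big; apply: eq_bigr => i _; apply: eq_bigr => j _ /=.
rewrite [RHS]mxE; apply: eq_bigr => q _; congr (_ * _); last by rewrite mxE.
by rewrite [RHS]mxE; apply: eq_bigr => p _; rewrite !mxE amplE.
Qed.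

Definition classical_map (X : finType) d (D : X -> 'M[C]_d) (f : obsalg R X 1) :
  obsalg R unit d := [ffun _ => \sum_x f x 0 0 *: D x].

Definition coefs k (b : 'M[C]_(k * 1)) : 'M[C]_k :=
  \matrix_(i, j) b (mxtens_index (i, 0)) (mxtens_index (j, 0)).

Lemma classical_map_form (X : finType) d k (D : X -> 'M[C]_d) (a : obsalg R X (k * 1))
    (w w' : 'cV[C]_(k * d)) :
  (w ^t* *m ampl (classical_map D) a tt *m w') 0 0 =
  cbform D (fun x => coefs (a x)) (slice w) (slice w').
Proof.
rewrite ampl_form.
have E i j : ((slice w) ^t* *m classical_map D (block a i j) tt *m slice w') i j =
    \sum_x coefs (a x) i j * ((slice w) ^t* *m D x *m slice w') i j.
  rewrite ffunE mulmx_sumr mulmx_suml summxE; apply: eq_bigr => x _.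
  by rewrite -scalemxAr -scalemxAl ffunE !mxE.
under eq_bigr => i _ do under eq_bigr => j _ do rewrite E.
under eq_bigr => i _ do rewrite exchange_big /=.
rewrite exchange_big /cbform; apply: eq_bigr => x _ /=.
rewrite exchange_big; apply: eq_bigr => j _ /=.
rewrite [RHS]mxE; apply: eq_bigr => i _; congr (_ * _).
by rewrite [RHS]mxE.
Qed.

Lemma hsn_l2norm n (v : 'cV[C]_n) : hsn v = ((l2norm v) ^+ 2)%:C%C.
Proof.
rewrite /l2norm sqr_sqrtr; last by apply: sumr_ge0 => i _; rewrite sqr_ge0.
rewrite hsnE big_ord1 raddf_sum; apply: eq_bigr => i _ /=.
by rewrite rmorphXn.
Qed.

Lemma l2norm_le n (v : 'cV[C]_n) (r : R) : 0 <= r ->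
  (l2norm v <= r) = (hsn v <= (r ^+ 2)%:C%C).
Proof. by move=> r0; rewrite hsn_l2norm lecR ler_pXn2r // nnegrE sqrtr_ge0. Qed.

Lemma opnorm_le n (B : 'M[C]_n) (r : R) : 0 < r ->
  (opnorm B <= r%:E)%E <-> (forall v : 'cV_n, hsn (B *m v) <= (r ^+ 2)%:C%C * hsn v).
Proof.
move=> r0; split => [h v | h]; last first.
  apply: ge_ereal_sup => _ [v /= v1 <-]; rewrite lee_fin (l2norm_le _ (ltW r0)).
  apply: le_trans (h v) _; rewrite ler_piMr ?ler0c ?sqr_ge0 //.
  by move: v1; rewrite (l2norm_le _ ler01) expr1n.
have [->|v0] := eqVneq v 0; first by rewrite mulmx0 /hsn mulmx0 mxtrace0 mulr0.
pose t := l2norm v.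
have t0 : 0 < t.
  rewrite lt_neqAle sqrtr_ge0 andbT eq_sym; apply: contra v0 => /eqP t0.
  by rewrite -hsn_eq0 hsn_l2norm -/t t0 expr0n.
pose u := (t^-1)%:C%C *: v.
have u1 : hsn u = 1.
  rewrite hsnZ hsn_l2norm -/t normc_def /= expr0n addr0 sqrtr_sqr -rmorphXn -rmorphM.
  by rewrite -exprMn ger0_norm ?invr_ge0 ?(ltW t0) // mulVf ?gt_eqF // expr1n.
have : (l2norm (B *m u) <= r)%R.
  rewrite -lee_fin; apply: le_trans h; apply: ereal_sup_ubound.
  by exists u => //=; rewrite (l2norm_le _ ler01) u1 expr1n.
rewrite (l2norm_le _ (ltW r0)) -scalemxAr => hu.
have -> : hsn (B *m v) = (t ^+ 2)%:C%C * hsn ((t^-1)%:C%C *: (B *m v)).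
  rewrite hsnZ normc_def /= expr0n addr0 sqrtr_sqr -rmorphXn mulrA -rmorphM.
  by rewrite -exprMn ger0_norm ?invr_ge0 ?(ltW t0) // mulfV ?gt_eqF // expr1n mul1r.
by rewrite (hsn_l2norm v) mulrC ler_wpM2r // ler0c sqr_ge0.
Qed.

Lemma obsnorm_le (Y : finType) n (a : obsalg R Y n) (r : R) : 0 <= r ->
  (obsnorm a <= r%:E)%E <-> (forall y, (opnorm (a y) <= r%:E)%E).
Proof.
move=> r0; rewrite /obsnorm; split => [h y | h].
  by apply: le_trans h; apply: (le_bigmax_cond _ (fun y => opnorm (a y))).
by apply: bigmax_le => // y _; apply: h.
Qed.
End Amplification.

(** * Completely bounded norms of classical maps, and maps on classical observables *)

Section Channels.
Variable R : realType.
Local Notation C := R[i].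

Lemma contr_opnorm k (b : 'M[C]_k) : contraction b <-> (opnorm b <= 1%:E)%E.
Proof.
rewrite opnorm_le //.
by split=> h v; have := h v; rewrite expr1n mul1r.
Qed.

Lemma contr_coefs k (b : 'M[C]_(k * 1)) : contraction b -> contraction (coefs b).
Proof.
move=> cb g; have := cb (unslice g^T); rewrite hsn_unslice hsn_tr.
congr (_ <= _); rewrite -hsn_slice -[RHS]hsn_tr; congr hsn.
apply/matrixP => i j; rewrite !mxE ord1 sum_mxtens; apply: eq_bigr => l _.
by rewrite big_ord1 !mxE mxtens_indexK.
Qed.

Definition uncoefs k (b : 'M[C]_k) : 'M[C]_(k * 1) :=
  \matrix_(l, m) b (mxtens_unindex l).1 (mxtens_unindex m).1.

Lemma uncoefsK k : cancel (@uncoefs k) (@coefs R k).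
Proof. by move=> b; apply/matrixP => i j; rewrite !mxE !mxtens_indexK. Qed.

Lemma contr_uncoefs k (b : 'M[C]_k) : contraction b -> contraction (uncoefs b).
Proof.
move=> cb w; have := cb (slice w)^T; rewrite hsn_tr hsn_slice.
congr (_ <= _); rewrite -hsn_slice -[RHS]hsn_tr; congr hsn.
apply/matrixP => i j; rewrite !mxE sum_mxtens; apply: eq_bigr => l _.
by rewrite big_ord1 !mxE !mxtens_indexK ord1.
Qed.

(** Testing with [w = c^-1 B v] on the left, the arithmetic-mean bound reads [c^-1 |Bv|^2 <= (c^-1
    |Bv|^2 + c |v|^2) / 2], that is [|Bv| <= c |v|]. *)
Lemma cbnorm_classical_map_le (X : finType) d (D : X -> 'M[C]_d) (c : R) : 0 < c ->
  cb_bounded D c%:C%C -> (cbnorm (classical_map D) <= c%:E)%E.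
Proof.
move=> c0 cb; have c0C : 0 < c%:C%C :> C by rewrite ltcR.
apply: ge_ereal_sup => _ [k _ <-]; apply: ge_ereal_sup => _ [a /= a1 <-].
apply/obsnorm_le; first exact: ltW.
case; apply/opnorm_le => // v.
set B := ampl _ _ _; pose w := (c%:C%C)^-1 *: (B *m v).
have ca x : contraction (coefs (a x)).
  by apply/contr_coefs/contr_opnorm; move: x; apply/obsnorm_le.
have := cb _ _ (slice w) (slice v) ca; rewrite -classical_map_form !hsn_slice -/B.
have -> : (w ^t* *m B *m v) 0 0 = (c%:C%C)^-1 * hsn (B *m v).
  rewrite /w adjZ -mulmxA -scalemxAl mxE /hsn mxtrace11; congr (_ * _).
  by rewrite geC0_conj // invr_ge0 ltW.
have i0 : 0 <= (c%:C%C)^-1 :> C by rewrite invr_ge0 ltW.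
rewrite ger0_norm; last by rewrite mulr_ge0 ?hsn_ge0.
rewrite hsnZ (ger0_norm i0) => h.
rewrite rmorphXn -subr_ge0.
have -> : (c%:C%C : C) ^+ 2 * hsn v - hsn (B *m v) = 2 * c%:C%C *
    (c%:C%C * ((c%:C%C)^-1 ^+ 2 * hsn (B *m v) + hsn v) / 2 -
     (c%:C%C)^-1 * hsn (B *m v)).
  by field; rewrite gt_eqF.
by rewrite mulr_ge0 ?subr_ge0 // mulr_ge0 // ltW.
Qed.

(** Conversely, contractions [a x] form an amplified observable of norm at most 1, and [hs_le] with
    weight [c] turns [|Bv| <= c |v|] into the arithmetic-mean bound. *)
Lemma cb_bounded_cbnorm_classical_map (X : finType) d (D : X -> 'M[C]_d) (c : R) : 0 < c ->
  (cbnorm (classical_map D) <= c%:E)%E -> cb_bounded D c%:C%C.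
Proof.
move=> c0 cb k a U V ca; have c0C : 0 < c%:C%C :> C by rewrite ltcR.
pose b : obsalg R X (k * 1) := [ffun x => uncoefs (a x)].
have b1 : (obsnorm b <= 1%:E)%E.
  apply/obsnorm_le => // x; rewrite ffunE; apply/contr_opnorm.
  exact: contr_uncoefs.
set B := ampl (classical_map D) b tt.
have Bc : (opnorm B <= c%:E)%E.
  have /obsnorm_le : (obsnorm (ampl (classical_map D) b) <= c%:E)%E.
    apply: le_trans cb; apply: le_trans (ereal_sup_ubound _) => /=; last first.
      by exists k.
    by apply: ereal_sup_ubound; exists b.
  by apply; apply: ltW.
have -> : cbform D a U V = ((unslice U) ^t* *m B *m unslice V) 0 0.
  rewrite classical_map_form !unsliceK /cbform; apply: eq_bigr => x _.
  by rewrite ffunE uncoefsK.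
rewrite -mulmxA -mxtrace11; apply: le_trans (hs_le _ _ c0C) _.
rewrite ler_pM2r ?invr_gt0 // mulrDr hsn_unslice lerD2l.
have /opnorm_le := Bc => /(_ c0 (unslice V)).
rewrite hsn_unslice rmorphXn -(ler_pM2l (x := (c%:C%C)^-1)) ?invr_gt0 //.
by rewrite expr2 -mulrA mulKf // gt_eqF.
Qed.

Lemma cb_bounded_add (X : finType) d (D D' : X -> 'M[C]_d) (c c' : C) :
  cb_bounded D c -> cb_bounded D' c' -> cb_bounded (fun x => D x + D' x) (c + c').
Proof.
move=> h h' k a U V ca.
have -> : cbform (fun x => D x + D' x) a U V = cbform D a U V + cbform D' a U V.
  rewrite /cbform -big_split; apply: eq_bigr => x _ /=.
  by rewrite mulmxDr mulmxDl mulmxDr mxtraceD.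
apply: le_trans (ler_normD _ _) _; rewrite !mulrDl.
by apply: lerD; rewrite -?mulrDl; [apply: h | apply: h'].
Qed.

Lemma channel_pos (Y Y' : finType) m m' (T : obsalg R Y m -> obsalg R Y' m') a :
  channel T -> obs_pos a -> obs_pos (T a).
Proof.
move=> [_ cp _] a0 y v.
pose a' : obsalg R Y (1 * m) := [ffun y => \matrix_(l, l')
  a y (mxtens_unindex l).2 (mxtens_unindex l').2].
have ba : block a' 0 0 = a.
  apply/ffunP => x; apply/matrixP => p q.
  by rewrite !(ffunE, mxE) !mxtens_indexK.
have a'0 : obs_pos a'.
  move=> x w; have := a0 x (slice w); congr (_ <= _).
  rewrite !mxE sum_mxtens big_ord1; apply: eq_bigr => p _; rewrite !mxE; congr (_ * _).
  rewrite sum_mxtens big_ord1; apply: eq_bigr => q _.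
  by rewrite !(ffunE, mxE) !mxtens_indexK.
have := cp 1%N a' a'0 y (unslice v); rewrite ampl_form !big_ord1 ba unsliceK.
by congr (_ <= _); rewrite !ord1.
Qed.

Definition classical_obs (X : finType) (x : X) : obsalg R X 1 :=
  [ffun x' => ((x' == x)%:R)%:M].

Lemma classical_obsE (X : finType) (f : obsalg R X 1) :
  f = \sum_x f x 0 0 *: classical_obs x.
Proof.
apply/ffunP => x'; rewrite sum_ffunE (bigD1 x') //= big1 => [|x ne].
  by rewrite addr0 !ffunE eqxx scale_scalar_mx mulr1 -mx11_scalar.
by rewrite !ffunE eq_sym (negbTE ne) scale_scalar_mx mulr0 raddf0.
Qed.

Lemma sum_classical_obs (X : finType) : \sum_x classical_obs x = obs1 R X 1.
Proof.
rewrite [RHS]classical_obsE; apply: eq_bigr => x _.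
by rewrite ffunE mxE scale1r.
Qed.

Lemma linear_fun_sum (U V : lmodType C) (T : U -> V) (I : finType) (F : I -> U) :
  linear T -> T (\sum_i F i) = \sum_i T (F i).
Proof.
move=> lT; pose Tl : {linear U -> V} :=
  HB.pack T (GRing.isLinear.Build _ _ _ _ T lT).
exact: (linear_sum Tl).
Qed.

Lemma linear_fun_scale (U V : lmodType C) (T : U -> V) (c : C) (u : U) :
  linear T -> T (c *: u) = c *: T u.
Proof.
move=> lT; pose Tl : {linear U -> V} :=
  HB.pack T (GRing.isLinear.Build _ _ _ _ T lT).
have T0 : T 0 = 0 := linear0 Tl.
by have := lT c u 0; rewrite T0 !addr0.
Qed.

Lemma classical_map_linear (X : finType) d (T : obsalg R X 1 -> obsalg R unit d) :
  linear T -> T = classical_map (fun x => T (classical_obs x) tt).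
Proof.
move=> lT; apply: funext => f; rewrite {1}(classical_obsE f) linear_fun_sum //.
apply/ffunP => -[]; rewrite sum_ffunE ffunE; apply: eq_bigr => x _.
by rewrite linear_fun_scale // ffunE.
Qed.
End Channels.

(** * The joint measurement defined by an instrument *)

Section ErrorDisturbance.
Variable R : realType.
Local Notation C := R[i].

Lemma form_block (Y : finType) m k (a : obsalg R Y (k * m)) y
    (w w' : 'cV[C]_(k * m)) :
  (w ^t* *m a y *m w') 0 0 =
  \sum_i \sum_j ((slice w) ^t* *m block a i j y *m slice w') i j.
Proof.
rewrite -(ampl_form id); congr ((_ *m _ *m _) 0 0).
apply/matrixP => l l'; case: (mxtens_indexP l) => i p.
by case: (mxtens_indexP l') => j q; rewrite amplE !(ffunE, mxE).
Qed.

(** In the Schroedinger picture: given [x], draw [z] with probability [T x z] and prepare the pure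
    state [theta z]. *)
Definition randomize (X Z : finType) d (theta : Z -> 'cV[C]_d) (T : X -> Z -> C)
    (a : obsalg R unit d) : obsalg R X 1 :=
  [ffun x => \sum_z T x z *: ((theta z) ^t* *m a tt *m theta z)].

Lemma randomize_channel (X Z : finType) d (theta : Z -> 'cV[C]_d)
    (T : X -> Z -> C) :
  (forall z, (theta z) ^t* *m theta z = 1%:M) -> (forall x z, 0 <= T x z) ->
  (forall x, \sum_z T x z = 1) -> channel (randomize theta T).
Proof.
move=> th1 T0 T1; split.
- move=> c a b; apply/ffunP => x; rewrite !ffunE scaler_sumr -big_split /=.
  apply: eq_bigr => z _; rewrite mulmxDr mulmxDl scalerDr; congr (_ + _).
  by rewrite -scalemxAr -scalemxAl !scalerA mulrC.
- move=> k a a0 x w; rewrite ampl_form.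
  (* The amplified form at [w] is a nonnegative combination of the forms of [a] at the product
     vectors of [w] and [theta z]. *)
  have -> : \sum_i \sum_j
        ((slice w) ^t* *m randomize theta T (block a i j) x *m slice w) i j =
      \sum_z T x z * ((unslice (theta z *m slice w)) ^t* *m a tt *m
         unslice (theta z *m slice w)) 0 0.
    under [RHS]eq_bigr => z _ do rewrite form_block unsliceK mulr_sumr.
    rewrite [RHS]exchange_big; apply: eq_bigr => i _ /=.
    under [RHS]eq_bigr => z _ do rewrite mulr_sumr.
    rewrite [RHS]exchange_big; apply: eq_bigr => j _ /=.
    rewrite ffunE mulmx_sumr mulmx_suml summxE; apply: eq_bigr => z _.
    by rewrite -scalemxAr -scalemxAl mxE adjM !mulmxA.
  by apply: sumr_ge0 => z _; apply: mulr_ge0.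
- apply/ffunP => x; rewrite !ffunE.
  under eq_bigr => z _ do rewrite mulmx1 th1.
  by rewrite -scaler_suml T1 scale1r.
Qed.

Lemma delta_le (X : finType) d (S T : obsalg R X 1 -> obsalg R unit d)
    (D : X -> 'M[C]_d) (e : R) :
  (fun a => S a - T a) = classical_map D -> 0 < e ->
  cb_bounded D (2 * e%:C%C) <-> (delta S T <= e%:E)%E.
Proof.
move=> DE e0; rewrite /delta DE lee_pdivrMl // -EFinM.
have e20 : 0 < 2 * e by rewrite mulr_gt0.
have -> : 2 * e%:C%C = (2 * e)%:C%C :> C by rewrite rmorphM rmorph_nat.
by split=> [/(cbnorm_classical_map_le e20) | /(cb_bounded_cbnorm_classical_map e20)].
Qed.

Definition onb (X : finType) d (phi : X -> 'cV[C]_d) :=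
  (forall x y, (phi x) ^t* *m phi y = ((x == y)%:R)%:M) /\
  \sum_x phi x *m (phi x) ^t* = 1%:M.

(** Preparing [theta z] and measuring in the same basis returns [z], so only the classical kernel
    [T] remains. *)
Lemma randomize_meas (X Z : finType) d (theta : Z -> 'cV[C]_d)
    (T : X -> Z -> C) (f : obsalg R Z 1) x :
  (forall z z', (theta z) ^t* *m theta z' = ((z == z')%:R)%:M) ->
  randomize theta T (ideal_meas theta f) x 0 0 = \sum_z T x z * f z 0 0.
Proof.
move=> on; rewrite ffunE summxE; apply: eq_bigr => z _; rewrite mxE; congr (_ * _).
rewrite ffunE mulmx_sumr mulmx_suml summxE (bigD1 z) //= big1 => [|z' ne].
  rewrite addr0 -scalemxAr -scalemxAl mulmxA on eqxx mul1mx on eqxx.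
  by rewrite !mxE mulr1.
rewrite -scalemxAr -scalemxAl mulmxA on eq_sym (negbTE ne) mul_scalar_mx.
by rewrite scale0r mul0mx scaler0 mxE.
Qed.

Lemma eigenbasis_onb (X : finType) d (B : 'M[C]_d) (phi : X -> 'cV[C]_d) :
  orthonormal_eigenbasis B phi -> onb phi.
Proof.
move=> [on gen _].
have on' x y : (phi x) ^t* *m phi y = ((x == y)%:R)%:M.
  by rewrite [LHS]mx11_scalar on.
split=> //.
have fixed i : (\sum_x phi x *m (phi x) ^t* ) *m delta_mx i 0 = delta_mx i 0 :> 'cV_d.
  have [c ->] := gen (delta_mx i 0).
  rewrite mulmx_suml; apply: eq_bigr => x _.
  rewrite -mulmxA mulmx_sumr (bigD1 x) //= big1 ?addr0 => [|y ne].
    by rewrite -scalemxAr on' eqxx scalemx1 mul_mx_scalar.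
  by rewrite -scalemxAr on' eq_sym (negbTE ne) raddf0 scaler0.
apply/matrixP => j i; have := congr1 (fun v : 'cV_d => v j 0) (fixed i).
by rewrite -colE mxE => ->; rewrite !mxE andbT.
Qed.

Lemma sqrtC_real (r : R) : 0 <= r -> sqrtC r%:C%C = (Num.sqrt r)%:C%C :> C.
Proof.
move=> r0; rewrite -[in LHS](sqr_sqrtr r0) rmorphXn sqrCK // ler0c.
exact: sqrtr_ge0.
Qed.

(** Triangle inequality through the second marginal of the joint measurement: [v] bounds its
    distance to the ideal one, [postprocessing] its distance to [sum_x T x z P_x], and the recovery
    [randomize theta T] realises the latter. *)
Lemma complementarity_le (X Z : finType) d (phi : X -> 'cV[C]_d)
    (theta : Z -> 'cV[C]_d) (A : X -> Z -> 'M[C]_d) (e v s : R) :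
  onb phi -> onb theta -> \sum_x \sum_z (A x z) ^t* *m A x z = 1%:M ->
  0 <= e -> 0 <= v -> 0 < s ->
  cb_bounded (fun x => phi x *m (phi x) ^t* - \sum_z (A x z) ^t* *m A x z)
    (2 * e%:C%C) ->
  cb_bounded (fun z => theta z *m (theta z) ^t* - \sum_x (A x z) ^t* *m A x z)
    (2 * v%:C%C) ->
  (complementarity phi theta <= (Num.sqrt (2 * (e + s)) + v)%:E)%E.
Proof.
move=> [phi_on phi1] [th_on th1] A1 e0 v0 s0 cbX cbZ.
have [|||T [T0 T1 cbT]] := @postprocessing R X Z d phi A phi_on phi1 A1 e%:C%C s%:C%C.
- by rewrite ler0c.
- by rewrite ltcR.
- exact: cbX.
have es0 : 0 < Num.sqrt (2 * (e + s)) by rewrite sqrtr_gt0 mulr_gt0 // ltr_wpDl.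
have chT : channel (randomize theta T).
  by apply: randomize_channel => // z; rewrite th_on eqxx.
apply: le_trans (ereal_inf_lbound _) _ => /=.
  by exists (randomize theta T); [exact: chT | reflexivity].
apply/(@delta_le _ _ _ _ (fun z => theta z *m (theta z) ^t* -
   \sum_x T x z *: (phi x *m (phi x) ^t* ))).
- apply: funext => f; apply/ffunP => -[]; rewrite !ffunE.
  under [X in _ - X]eq_bigr => x _ do rewrite randomize_meas // scaler_suml.
  rewrite exchange_big -sumrB; apply: eq_bigr => z _ /=.
  rewrite scalerBr scaler_sumr; congr (_ - _); apply: eq_bigr => x _.
  by rewrite scalerA mulrC.
- by rewrite ltr_wpDr.
have -> : (fun z => theta z *m (theta z) ^t* -
   \sum_x T x z *: (phi x *m (phi x) ^t* )) =
   (fun z => (theta z *m (theta z) ^t* - \sum_x (A x z) ^t* *m A x z) +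
     \sum_x ((A x z) ^t* *m A x z - T x z *: (phi x *m (phi x) ^t* ))).
  by apply: funext => z; rewrite sumrB addrA subrK.
have -> : 2 * (Num.sqrt (2 * (e + s)) + v)%:C%C = 2 * v%:C%C +
    2 * sqrtC (2 * (e%:C%C + s%:C%C)) :> C.
  have -> : 2 * (e%:C%C + s%:C%C) = (2 * (e + s))%:C%C :> C.
    by rewrite rmorphM rmorph_nat rmorphD.
  rewrite sqrtC_real; last by rewrite mulr_ge0 // addr_ge0 // ltW.
  by rewrite rmorphD mulrDr addrC.
exact: cb_bounded_add.
Qed.

(** The outcome [y] is classical and can be copied, so postprocessing and recovery apply together:
    the effect of the pair [x], [z] is [E] of the pointwise product [g x z] of their outputs.
    Unitality of [P2] and of [P1] gives the two marginals. *)
Lemma joint_instrument (X Z Y : finType) d n (theta : Z -> 'cV[C]_d)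
    (E : obsalg R Y n -> obsalg R unit d) (P1 : obsalg R X 1 -> obsalg R Y 1)
    (P2 : obsalg R unit d -> obsalg R Y n) :
  onb theta -> channel E -> channel P1 -> channel P2 ->
  exists A : X -> Z -> 'M[C]_d,
  [/\ \sum_x \sum_z (A x z) ^t* *m A x z = 1%:M,
    (fun f => E (tens1 n (P1 f))) = classical_map (fun x => \sum_z (A x z) ^t* *m A x z) &
    E \o P2 \o ideal_meas theta = classical_map (fun z => \sum_x (A x z) ^t* *m A x z)].
Proof.
move=> [th_on th1] chE ch1 ch2.
have [lE _ E1] := chE; have [l1 _ P11] := ch1; have [l2 _ P21] := ch2.
have lt : linear (@tens1 R Y n).
  move=> c a b; apply/ffunP => y; rewrite !ffunE !mxE.
  by rewrite raddfD /= scale_scalar_mx.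
have lQ : linear (@ideal_meas R d Z theta).
  move=> c a b; apply/ffunP => y; rewrite !ffunE scaler_sumr -big_split /=.
  by apply: eq_bigr => z _; rewrite !ffunE !mxE scalerDl scalerA.
pose q z := ideal_meas theta (classical_obs R z).
have qE z : q z tt = theta z *m (theta z) ^t*.
  rewrite ffunE (bigD1 z) //= big1 ?addr0 => [|z' ne].
    by rewrite ffunE eqxx mxE scale1r.
  by rewrite ffunE (negbTE ne) mxE mul0rn scale0r.
have sumq : \sum_z q z = obs1 R unit d.
  by apply/ffunP => -[]; rewrite sum_ffunE ffunE -th1; apply: eq_bigr => z _.
pose p x := P1 (classical_obs R x).
have sump : \sum_x p x = obs1 R Y 1.
  by rewrite -(linear_fun_sum _ l1) sum_classical_obs P11.
pose g x z : obsalg R Y n := [ffun y => p x y 0 0 *: P2 (q z) y].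
have g0 x z : obs_pos (g x z).
  move=> y; rewrite ffunE; apply: psdZ.
    have /(_ y 1%:M) : obs_pos (p x).
      apply: (channel_pos ch1) => x' w; rewrite ffunE.
      rewrite mul_mx_scalar -scalemxAl mxE mulr_ge0 //.
      by rewrite -mxtrace11; apply: hsn_ge0.
    by rewrite trmx1 map_mx1 mul1mx mulmx1.
  move: y; apply: (channel_pos ch2) => -[] w; rewrite qE.
  by have := psd_gram ((theta z) ^t* ) w; rewrite trmxCK.
have Eg0 x z : psd (E (g x z) tt) by apply: (channel_pos chE (g0 x z)).
have [A AE] := choice (fun xz : X * Z => psd_factor (Eg0 xz.1 xz.2)).
have gx x : \sum_z g x z = tens1 n (p x).
  apply/ffunP => y; rewrite sum_ffunE.
  under eq_bigr => z _ do rewrite ffunE.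
  rewrite -scaler_sumr -sum_ffunE -(linear_fun_sum _ l2) sumq P21 !ffunE.
  by rewrite scale_scalar_mx mulr1.
have gz z : \sum_x g x z = P2 (q z).
  apply/ffunP => y; rewrite sum_ffunE.
  under eq_bigr => x _ do rewrite ffunE.
  rewrite -scaler_suml -summxE -sum_ffunE sump ffunE mxE.
  by rewrite scale1r.
have Ex x : E (tens1 n (p x)) tt = \sum_z (A (x, z)) ^t* *m A (x, z).
  rewrite -gx (linear_fun_sum _ lE) sum_ffunE; apply: eq_bigr => z _.
  exact: (AE (x, z)).
have Ez z : E (P2 (q z)) tt = \sum_x (A (x, z)) ^t* *m A (x, z).
  rewrite -gz (linear_fun_sum _ lE) sum_ffunE; apply: eq_bigr => x _.
  exact: (AE (x, z)).
exists (fun x z => A (x, z)); split.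
- under eq_bigr => x _ do rewrite -Ex.
  transitivity ((\sum_x E (tens1 n (p x))) tt); first by rewrite sum_ffunE.
  rewrite -(linear_fun_sum (fun x => tens1 n (p x)) lE) -(linear_fun_sum p lt) sump.
  have -> : tens1 n (obs1 R Y 1) = obs1 R Y n.
    by apply/ffunP => y; rewrite !ffunE mxE.
  by rewrite E1 [LHS]ffunE.
- rewrite [LHS]classical_map_linear => [|c a b]; last by rewrite l1 lt lE.
  by congr classical_map; apply: funext => x; rewrite -Ex.
- rewrite [LHS]classical_map_linear => [|c a b /=]; last by rewrite lQ l2 lE.
  by congr classical_map; apply: funext => z; rewrite -Ez.
Qed.
End ErrorDisturbance.

(** * Passage to the infima *)

Section MainBound.
Variable R : realType.
Local Notation C := R[i].

Lemma cbnorm_ge0 (Y Y' : finType) m m' (T : obsalg R Y m -> obsalg R Y' m') :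
  (0 <= cbnorm T)%E.
Proof.
apply: le_trans (ereal_sup_ubound _); last by exists 0%N.
apply: le_trans (ereal_sup_ubound _); last first.
  exists 0 => //=; apply/obsnorm_le => // y; apply/opnorm_le => // v.
  by rewrite ffunE mul0mx /hsn mulmx0 mxtrace0 expr1n mul1r hsn_ge0.
exact: bigmax_ge_id.
Qed.

Lemma delta_ge0 (Y Y' : finType) m m' (S T : obsalg R Y m -> obsalg R Y' m') :
  (0 <= delta S T)%E.
Proof. by rewrite mule_ge0 ?cbnorm_ge0 // lee_fin invr_ge0. Qed.

Lemma meas_error_ge0 (d : nat) (X : finType) (phi : X -> 'cV[C]_d) (Y : finType) n
    (E : obsalg R Y n -> obsalg R unit d) : (0 <= meas_error phi E)%E.
Proof. by apply: le_ereal_inf_tmp => _ [P _ <-]; apply: delta_ge0. Qed.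

Lemma meas_disturbance_ge0 (d : nat) (Z : finType) (theta : Z -> 'cV[C]_d)
    (Y : finType) n (E : obsalg R Y n -> obsalg R unit d) :
  (0 <= meas_disturbance theta E)%E.
Proof. by apply: le_ereal_inf_tmp => _ [P _ <-]; apply: delta_ge0. Qed.

(** The infima [a] and [b] are only approached from above; continuity of the square root closes the
    gap. If [a] or [b] is infinite, so is the right-hand side. *)
Lemma sqrte_limit (c a b : \bar R) : (0 <= a)%E -> (0 <= b)%E ->
  (forall u v s : R, 0 < s -> (a < u%:E)%E -> (b < v%:E)%E ->
     (c <= (Num.sqrt (2 * (u + s)) + v)%:E)%E) ->
  (c <= sqrte (2%:E * a) + b)%E.
Proof.
case: a => [a||] // a0; case: b => [b||] // b0 h; last 3 first.
- by rewrite addey ?leey // -ltNye (lt_le_trans _ (sqrte_ge0 _)) ?ltNy0.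
- by rewrite gt0_muley ?lte_fin //= addye ?leey.
- by rewrite gt0_muley ?lte_fin //= addye ?leey.
rewrite !lee_fin in a0 b0; apply/lee_addgt0Pr => t t0.
(* The shifts by [m ^ 2] raise the root by at most [2 m], as [(sqrt (2 a) + 2 m)^2 >= 2 a + 4 m^2],
   and the other summand by [m ^ 2 <= m]: in total at most [3 m <= t]. *)
pose m := Num.min t 1 / 4.
have mt0 : 0 < Num.min t 1 by rewrite lt_min t0 ltr01.
have m0 : 0 < m by rewrite divr_gt0.
have mt : 4 * m <= t by rewrite mulrC divfK // ge_min lexx.
have m1 : 4 * m <= 1 by rewrite mulrC divfK // ge_min lexx orbT.
have s0 : 0 < m ^+ 2 by rewrite exprn_gt0.
apply: le_trans (h (a + m ^+ 2) (b + m ^+ 2) (m ^+ 2) s0 _ _) _.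
- by rewrite lte_fin ltrDl.
- by rewrite lte_fin ltrDl.
rewrite -EFinM /= -!EFinD lee_fin.
have : Num.sqrt (2 * (a + m ^+ 2 + m ^+ 2)) <= Num.sqrt (2 * a) + 2 * m.
  rewrite -[leRHS]ger0_norm; last by rewrite addr_ge0 ?sqrtr_ge0 // mulr_ge0 // ltW.
  rewrite -sqrtr_sqr ler_sqrt ?sqr_ge0 // sqrrD sqr_sqrtr ?mulr_ge0 //.
  rewrite -subr_ge0.
  have -> : 2 * a + Num.sqrt (2 * a) * (2 * m) *+ 2 + (2 * m) ^+ 2 -
     2 * (a + m ^+ 2 + m ^+ 2) = Num.sqrt (2 * a) * (2 * m) *+ 2 by ring.
  by rewrite mulrn_wge0 // mulr_ge0 ?sqrtr_ge0 // mulr_ge0 // ltW.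
have : m ^+ 2 <= m by rewrite expr2 ler_piMl ?ltW //; lra.
lra.
Qed.

(** The strict inequalities supply a postprocessing and a recovery within [e] and [v]. One joint
    measurement serves both bounds: the second is the first with the indices of [A] and the two
    marginals exchanged. *)
Lemma error_disturbance (d : nat) (X Z Y : finType) (phi : X -> 'cV[C]_d)
    (theta : Z -> 'cV[C]_d) n (E : obsalg R Y n -> obsalg R unit d) :
  onb phi -> onb theta -> channel E -> forall e v s : R, 0 < s ->
  (meas_error phi E < e%:E)%E -> (meas_disturbance theta E < v%:E)%E ->
  (complementarity phi theta <= (Num.sqrt (2 * (e + s)) + v)%:E)%E /\
  (complementarity theta phi <= (Num.sqrt (2 * (v + s)) + e)%:E)%E.
Proof.
move=> onp ont chE e v s s0 he hv.
have e0 : 0 < e by rewrite -lte_fin (le_lt_trans _ he) // meas_error_ge0.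
have v0 : 0 < v by rewrite -lte_fin (le_lt_trans _ hv) // meas_disturbance_ge0.
move: he => /ereal_inf_lt[_ [P1 /= ch1 <-] /ltW d1].
move: hv => /ereal_inf_lt[_ [P2 /= ch2 <-] /ltW d2].
have [A [A1 AX AZ]] := joint_instrument ont chE ch1 ch2.
have diff (W : finType) (w : W -> 'cV[C]_d) (D : W -> 'M[C]_d) :
    (fun a => ideal_meas w a - classical_map D a) =
    classical_map (fun x => w x *m (w x) ^t* - D x).
  apply: funext => f; apply/ffunP => y; rewrite !ffunE -sumrB.
  by apply: eq_bigr => x _; rewrite scalerBr.
rewrite AX in d1; rewrite AZ in d2.
have cX := (delta_le (diff _ phi _) e0).2 d1.
have cZ := (delta_le (diff _ theta _) v0).2 d2.
split.
  by apply: (complementarity_le onp ont A1) => //; apply: ltW.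
apply: (@complementarity_le _ _ _ _ _ _ (fun z x => A x z)) => //.
- by rewrite exchange_big.
- exact: ltW.
- exact: ltW.
Qed.
End MainBound.

Theorem theorem1 (R : realType) (d : nat) (X Z : finType)
  (obsX obsZ : 'M[R[i]]_d)
  (phi : X -> 'cV[R[i]]_d) (theta : Z -> 'cV[R[i]]_d)
  (obsX_nondeg : nondegenerate_observable obsX)
  (obsZ_nondeg : nondegenerate_observable obsZ)
  (phi_basis : orthonormal_eigenbasis obsX phi)
  (theta_basis : orthonormal_eigenbasis obsZ theta)
  (Y : finType) (n : nat) (E : obsalg R Y n -> obsalg R unit d)
  (E_channel : channel E) :
  (complementarity phi theta
     <= sqrte (2%:E * meas_error phi E) + meas_disturbance theta E)%E /\
  (complementarity theta phi
     <= meas_error phi E + sqrte (2%:E * meas_disturbance theta E))%E.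
Proof.
have bound := error_disturbance (eigenbasis_onb phi_basis)
  (eigenbasis_onb theta_basis) E_channel.
split; last rewrite addeC; apply: sqrte_limit;
  rewrite ?meas_error_ge0 ?meas_disturbance_ge0 //.
- by move=> u v s s0 hu hv; case: (bound u v s s0 hu hv).
- by move=> u v s s0 hu hv; case: (bound v u s s0 hv hu).
Qed.
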